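(* Let $\lambda,\lambda',\beta>0$, let $m\ge 0$ be an integer, and let $0<\gamma<1$, $0<\gamma'<1$ with $\gamma'<1/(m+1)$. Let $\mathcal P,\mathcal P'$ be independent Poisson point processes on $\mathbb S=\mathbb R\times[0,1]$ with intensity measures $\lambda|\cdot|$ and $\lambda'|\cdot|$, respectively, and let $\Delta_m^\ast$ denote the typical $m$-simplex of the associated random connection hypergraph, with degree $\deg(\Delta_m^\ast)$. Then $$\lim_{k\to\infty}\frac{\log \mathbb P\bigl(\deg(\Delta_m^\ast)\ge k\bigr)}{\log k}=m-\frac{m+1}{\gamma}.$$
   Context: Let $\mathbb S=\mathbb R\times[0,1]$ (location times mark) and let $|\cdot|$ be Lebesgue measure (on $\mathbb S$ or $\mathbb R$, as appropriate). For $p=(x,u)\in\mathbb S$ and $p'=(z,w)\in\mathbb S$ put $F(p,p')=|x-z|\,u^{\gamma}w^{\gamma'}$. For $p\in\mathbb S$ let $B_F(p,\beta)=\{p'\in\mathbb S: F(p,p')\le\beta\}$, and for $\Delta\subseteq\mathbb S$ let $B_F(\Delta,\beta)=\bigcap_{p\in\Delta}B_F(p,\beta)$. The set of $m$-simplices is $\Sigma_m=\{\Delta_m\subseteq\mathcal P:\ \#(\Delta_m)=m+1,\ \mathcal P'\cap B_F(\Delta_m,\beta)\ne\varnothing\}$. The center $c(\Delta_m)\in\mathbb R$ is the location coordinate of the vertex of $\Delta_m$ with the lowest mark (in case of ties, of the left-most vertex among those with minimal mark). For a Borel set $A\subseteq\mathbb R$, $\Sigma_m^A=\{\Delta_m\in\Sigma_m: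 c(\Delta_m)\in A\}$, and $\lambda_m=\mathbb E[\#\Sigma_m^A]$ for any Borel $A$ with $|A|=1$ (this value is finite, non-zero and independent of $A$ under the stated parameter assumptions). The degree of a finite set $\Delta\subseteq\mathcal P$ is $\deg(\Delta)=\#(\mathcal P'\cap B_F(\Delta,\beta))$. The law of the typical $m$-simplex is defined, for nonnegative measurable functionals $f$, by $$\mathbb E[f(\Delta_m^\ast,\mathcal P,\mathcal P')]=\frac1{\lambda_m}\mathbb E\Bigl[\sum_{\Delta_m\in\Sigma_m^A}f\bigl(\Delta_m-c(\Delta_m),\mathcal P-c(\Delta_m),\mathcal P'-c(\Delta_m)\bigr)\Bigr],$$ where $A\subseteq\mathbb R$ is any Borel set with $|A|=1$ and $R-x=\{(y-x,u):(y,u)\in R\}$ for $R\subseteq\mathbb S$, $x\in\mathbb R$. In particular $\mathbb P(\deg(\Delta_m^\ast)\ge k)=\lambda_m^{-1}\,\mathbb E\bigl[\#\{\Delta_m\in\Sigma_m^A:\deg(\Delta_m)\ge k\}\bigr]$. *)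

(* Defs.v *)
From HB Require Import structures.
From mathcomp Require Import all_boot all_order all_algebra.
From mathcomp Require Import all_classical all_reals all_analysis.

Set Implicit Arguments.
Unset Strict Implicit.
Unset Printing Implicit Defensive.

Import Order.TTheory GRing.Theory Num.Theory.
Import numFieldNormedType.Exports.

Local Open Scope classical_set_scope.
Local Open Scope ring_scope.

(* A (simple) point process on a subset of R x R is encoded as a map X from the
   sample space to sets of points; the number of points of a configuration in B
   is [counting (X w `&` B)], with value +oo on infinite sets. *)

Section space.
Context {R : realType}.
Implicit Types (p q : R * R) (X D : set (R * R)).

(* A point is a pair (location, mark). *)
Definition strip : set (R * R) := [set: R] `*` `[0, 1].

Definition strip_measure (B : set (R * R)) : \bar R :=
  (@lebesgue_measure R \x @lebesgue_measure R)%E (B `&` strip).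

Definition locally_finite X : Prop :=
  forall K : set (R * R), compact K -> finite_set (X `&` K).

Definition shift (x : R) X : set (R * R) := [set (p.1 - x, p.2) | p in X].

End space.

Section point_process.
Context {R : realType} {d : measure_display} {Omega : measurableType d}.
Variable Pr : probability Omega R.
Implicit Types (X Y : Omega -> set (R * R)).

Definition count_event X (B : set (R * R)) (k : nat) : set Omega :=
  [set w | counting (X w `&` B) = (k%:R)%:E :> \bar R].

(* [poisson_prob r] is the Poisson law on nat, equal to the Dirac mass at 0 for
   r = 0 (unlike [poisson_pmf]); it does not depend on its second argument. *)
Record poisson_process (mu : set (R * R) -> \bar R) X : Prop := PoissonProcess {
  pp_strip : forall w, X w `<=` strip ;
  pp_locally_finite : forall w, locally_finite (X w) ;
  pp_measurable : forall (B : set (R * R)) (k : nat),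
    measurable B -> measurable (count_event X B k) ;
  pp_poisson : forall (B : set (R * R)) (k : nat),
    measurable B -> (mu B < +oo)%E ->
    Pr (count_event X B k) = poisson_prob (fine (mu B)) k [set k] ;
  pp_indep : forall (n : nat) (B : 'I_n -> set (R * R)) (k : 'I_n -> nat),
    (forall i, measurable (B i)) -> (forall i, (mu (B i) < +oo)%E) ->
    trivIset setT B ->
    Pr (\bigcap_(i in [set: 'I_n]) count_event X (B i) (k i))
    = (\prod_(i < n) Pr (count_event X (B i) (k i)))%E
}.

Definition process_sigma_algebra X : set (set Omega) :=
  <<s [set E | exists B : set (R * R), exists k : nat,
                 measurable B /\ E = count_event X B k] >>.

Definition independent_processes X Y : Prop :=
  forall E F : set Omega,
    process_sigma_algebra X E -> process_sigma_algebra Y F ->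
    Pr (E `&` F) = (Pr E * Pr F)%E.

End point_process.

Section hypergraph.
Context {R : realType}.
Variables (beta gamma gamma' : R).
Implicit Types (p q : R * R) (X Y D : set (R * R)).

Definition kernelF p q : R := `|p.1 - q.1| * p.2 `^ gamma * q.2 `^ gamma'.

Definition ballF p : set (R * R) :=
  [set q | strip q /\ kernelF p q <= beta].

Definition ballF_set D : set (R * R) := \bigcap_(p in D) ballF p.

Definition degree Y D : \bar R := counting (Y `&` ballF_set D).

Definition simplices (m : nat) X Y : set (set (R * R)) :=
  [set D | [/\ D `<=` X, (D #= `I_m.+1)%card & Y `&` ballF_set D !=set0]].

(* The vertex of lowest mark, the left-most one in case of ties (unique when D
   is finite and nonempty). *)
Definition is_center_vertex D p : Prop :=
  D p /\ forall q, D q -> p.2 < q.2 \/ (p.2 = q.2 /\ p.1 <= q.1).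

Definition center D : R := (xget (0, 0) (is_center_vertex D)).1.

Definition simplices_in (m : nat) (A : set R) X Y : set (set (R * R)) :=
  [set D | simplices m X Y D /\ A (center D)].

End hypergraph.

Section typical_simplex.
Context {R : realType} {d : measure_display} {Omega : measurableType d}.
Variables (Pr : probability Omega R) (beta gamma gamma' : R).
Variables (X Y : Omega -> set (R * R)) (m : nat) (A : set R).
Local Open Scope ereal_scope.

Definition simplex_intensity : \bar R :=
  \int[Pr]_w counting (simplices_in beta gamma gamma' m A (X w) (Y w)).

(* E[f(Delta*, X, Y)] for the Palm version Delta*; A is meant to be any Borel set
   of Lebesgue measure 1, on which the value does not depend. *)
Definition typical_simplex_expectation
    (f : set (R * R) -> set (R * R) -> set (R * R) -> \bar R) : \bar R :=
  (\int[Pr]_w \esum_(D in simplices_in beta gamma gamma' m A (X w) (Y w))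
     f (shift (center D) D) (shift (center D) (X w)) (shift (center D) (Y w)))
  / simplex_intensity.

Definition typical_degree_tail (k : nat) : \bar R :=
  typical_simplex_expectation (fun D _ Y' =>
    if k%:R%:E <= degree beta gamma gamma' Y' D then 1 else 0).

End typical_simplex.

(* Main.v *)
(** The degree of a simplex Delta has conditional mean proportional to the volume of
B_F(Delta), hence both bounds come from first moments.

Lower bound: restrict to simplices whose vertices all have marks of order
k^(-1/gamma) and lie within distance of order k of one another.  Their common
ball contains a window of the Y-process with 2k expected points, and they occur
with probability of order k^m (k^(-1/gamma))^(m+1).

Upper bound: by a Markov inequality of real order theta >= 1 for the Poisson law,
the expected number of simplices of degree at least k is O(k^(-theta)) whenever
the integral of |B_F(Delta)|^theta over (m+1)-tuples is finite.  Bounding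
|B_F(Delta)| by each |B_F(p_i)|, which is of order u_i^(-gamma), gives
|B_F(Delta)|^theta <= C |B_F(Delta)| prod_i u_i^(-gamma (theta - 1) / (m + 1)),
and the integral of the right-hand side factorizes over the vertices; it is finite
exactly when theta < (m + 1) / gamma - m and gamma' < 1 / (m + 1).

No Mecke formula is used: the tuples of points are approximated by tuples of
distinct cells of a grid of mesh 1/n, and Fatou's lemma lets n tend to infinity.
The counting functionals need not be measurable, as the integral of a nonnegative
function is here a lower integral, which is monotone anyway. *)

Require Import Defs.
From HB Require Import structures.
From mathcomp Require Import all_boot all_order all_algebra.
From mathcomp Require Import all_classical all_reals all_analysis.
From mathcomp Require Import perm measurable_realfun.
From mathcomp Require Import ring lra zify.

Set Implicit Arguments.
Unset Strict Implicit.
Unset Printing Implicit Defensive.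

Import Order.TTheory GRing.Theory Num.Theory.
Import numFieldNormedType.Exports.

Local Open Scope classical_set_scope.
Local Open Scope ring_scope.

(** * Integrals and the Poisson law *)

(** For [f] and [g] possibly nonmeasurable: the integral is the supremum of the integrals of the
    simple functions below the integrand, and a simple function below [f] is below [g]. *)
Lemma ge0_le_lower_integral d (T : measurableType d) (R : realType)
    (mu : {measure set T -> \bar R}) (f g : T -> \bar R) :
  (forall x, 0 <= f x)%E -> (forall x, f x <= g x)%E ->
  (\int[mu]_x f x <= \int[mu]_x g x)%E.
Proof.
move=> f0 fg.
have g0 x : (0 <= g x)%E by exact: le_trans (f0 x) (fg x).
rewrite !ge0_integralTE//; apply: ge_ereal_sup => _ [h hf <-].
by apply: ereal_sup_ubound; exists h => // x; exact: le_trans (hf x) (fg x).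
Qed.

Section exp_partial_sums.
Context {R : realType}.
Implicit Types (r : R) (i j k n : nat).

(** The sum stops at degree [n - 1], so that [expR (- r) * exp_sum r k] is the probability that a
    Poisson variable of mean [r] is less than [k]. *)
Definition exp_sum r n : R := \sum_(i < n) r ^+ i / i`!%:R.

Lemma exp_sumS r n : exp_sum r n.+1 = exp_sum r n + r ^+ n / n`!%:R.
Proof. by rewrite /exp_sum big_ord_recr. Qed.

Lemma exp_sum_le r n : 0 <= r -> exp_sum r n <= expR r.
Proof.
move=> r0; rewrite /expR /exp_sum -(big_mkord xpredT (fun i => r ^+ i / i`!%:R)).
apply: (@nondecreasing_cvgn_le _ (series (exp_coeff r))) => //.
  apply/nondecreasing_seqP => k; rewrite /series/= big_nat_recr//= lerDl.
  by rewrite exp_coeff_ge0.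
exact: is_cvg_series_exp_coeff.
Qed.

(** After cancelling the powers of [r], the claim is k^j <= j^j i (i - 1) ... (i - j + 1). It holds
    factor by factor, since k <= j (k - l) whenever l < j <= k. *)
Lemma exp_coeff_shift_le r j k i : 0 <= r -> (j <= k)%N -> (k <= i)%N ->
  (0 < k)%N ->
  r ^+ i / i`!%:R <= (j%:R * r / k%:R) ^+ j * (r ^+ (i - j) / (i - j)`!%:R).
Proof.
move=> r0 jk ki k0.
have ji : (j <= i)%N by exact: leq_trans ki.
have h : (k ^ j * (i - j)`! <= j ^ j * i`!)%N.
  rewrite -(ffact_fact ji) mulnA leq_mul2r; apply/orP; right.
  rewrite ffact_prod -[X in (k ^ X <= _)%N]card_ord -[X in (_ <= j ^ X * _)%N]card_ord.
  rewrite -!prod_nat_const -big_split/=; apply: leq_prod => l _.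
  have lj := ltn_ord l.
  have : (j * (k - l) <= j * (i - l))%N by rewrite leq_mul2l leq_sub2r ?orbT.
  apply: leq_trans; nia.
rewrite -{1}(subnK ji) exprD.
rewrite !exprMn exprVn mulrA.
have k0' : (0 : R) < k%:R ^+ j by rewrite exprn_gt0 ?ltr0n.
rewrite ler_pdivrMr ?ltr0n ?fact_gt0//.
rewrite [leRHS](_ : _ = r ^+ (i - j) * r ^+ j * ((j ^ j * i`!)%:R / (k ^ j * (i - j)`!)%:R)).
  rewrite ler_peMr ?mulr_ge0 ?exprn_ge0//.
  by rewrite ler_pdivlMr ?ltr0n ?muln_gt0 ?expn_gt0 ?k0 ?fact_gt0// mul1r ler_nat.
rewrite !natrM !natrX.
have f0 n : n`!%:R != 0 :> R by rewrite pnatr_eq0 -lt0n fact_gt0.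
by field; rewrite f0 gt_eqF.
Qed.

(** Markov inequality of integer order [j] for the Poisson law, up to the factor [expR r]. Each term
    of degree i >= k is at most (j r / k)^j times the term of degree i - j, and the latter terms sum
    to at most [expR r]. *)
Lemma exp_sum_tail_le r j k : 0 <= r -> (0 < j)%N -> (j <= k)%N ->
  expR r - exp_sum r k <= (j%:R * r / k%:R) ^+ j * expR r.
Proof.
move=> r0 j0 jk; have k0 : (0 < k)%N by exact: leq_trans jk.
rewrite lerBlDr {1}/expR; apply: limr_le.
  exact: is_cvg_series_exp_coeff.
near=> n; have kn : (k <= n)%N by near: n; exact: nbhs_infty_ge.
rewrite /series/= (big_cat_nat (leq0n k) kn)/= addrC /exp_sum.
rewrite big_mkord lerD//.
have -> : \sum_(k <= i < n) exp_coeff r i = \sum_(k <= i < n) r ^+ i / i`!%:R by [].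
apply: (@le_trans _ _ (\sum_(k <= i < n)
    (j%:R * r / k%:R) ^+ j * (r ^+ (i - j) / (i - j)`!%:R))).
  by rewrite big_nat_cond [leRHS]big_nat_cond; apply: ler_sum => i;
    rewrite andbT => /andP[ki _]; exact: exp_coeff_shift_le.
rewrite -mulr_sumr ler_wpM2l//.
  by rewrite exprn_ge0// divr_ge0// mulr_ge0.
apply: le_trans (exp_sum_le (n - j) r0).
rewrite /exp_sum -(big_mkord xpredT (fun i => r ^+ i / i`!%:R)).
have -> : \sum_(k <= i < n) r ^+ (i - j) / (i - j)`!%:R =
    \sum_(k - j <= i < n - j) r ^+ i / i`!%:R.
  by rewrite -{1}(subnK jk) big_addn; apply: eq_bigr => i _; rewrite addnK.
rewrite [leRHS](big_cat_nat (leq0n (k - j)) (leq_sub2r j kn))/= lerDr.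
by apply: sumr_ge0 => i _; rewrite divr_ge0// exprn_ge0.
Unshelve. all: by end_near. Qed.

(** Up to degree [k] each term is at least twice the preceding one, so the first [k] terms together
    are at most the next one; added to it they are still at most [expR r]. *)
Lemma exp_sum_le_half r k : (2 * k)%:R <= r -> exp_sum r k <= expR r / 2.
Proof.
move=> kr; have r0 : 0 <= r by exact: le_trans kr.
have h : exp_sum r k <= r ^+ k / k`!%:R.
  elim: k kr => [|k ih] kr.
    by rewrite /exp_sum big_ord0 divr_ge0// exprn_ge0.
  have kr' : (2 * k)%:R <= r by apply: le_trans kr; rewrite ler_nat leq_mul2l leqnSn.
  rewrite exp_sumS; apply: (@le_trans _ _ (2 * (r ^+ k / k`!%:R))).
    by rewrite mulr_natl mulr2n lerD2r ih.
  rewrite factS natrM invfM exprS [leRHS]mulrACA ler_wpM2r ?divr_ge0 ?exprn_ge0//.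
  by rewrite ler_pdivlMr// -natrM.
have := exp_sum_le k.+1 r0; rewrite exp_sumS; lra.
Qed.

End exp_partial_sums.

Lemma poisson_prob_set1 (R : realType) (r : R) n k : 0 <= r ->
  poisson_prob r n [set k] = (expR (- r) * (r ^+ k / k`!%:R))%:E.
Proof.
rewrite le_eqVlt => /predU1P[<-|r0].
  rewrite /poisson_prob ltxx oppr0 expR0 mul1r diracE; congr (_%:E).
  case: k => [|k]; first by rewrite mem_set// expr0 fact0 divr1.
  by rewrite memNset//= exprS mul0r mul0r.
rewrite /poisson_prob r0 esum_set1 ?lee_fin ?poisson_pmf_ge0//.
by rewrite /poisson_pmf r0 mulrC.
Qed.

(** * Counts of a Poisson process *)

Section counting.
Context {T : choiceType} {R : realType}.
Implicit Types S : set T.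

Lemma counting_ge0 S : (0 <= counting S :> \bar R)%E.
Proof. by rewrite /counting; case: ifPn => // _; rewrite leey. Qed.

Lemma counting_eq0 S : (counting S = 0 :> \bar R)%E <-> S = set0.
Proof.
split=> [|->]; last by rewrite /counting asboolT// fset_set0.
rewrite /counting; case: ifPn => // /asboolP fS [] /eqP.
by rewrite pnatr_eq0 finmap.cardfs_eq0 => /eqP /(fset_set_set0 fS).
Qed.

Lemma le_counting S1 S2 : S1 `<=` S2 -> (counting S1 <= counting S2 :> \bar R)%E.
Proof.
move=> S12; rewrite /counting; case: (asboolP (finite_set S2)) => [f2|_]; last by rewrite leey.
have f1 := sub_finite_set S12 f2.
rewrite asboolT// lee_fin ler_nat; apply: finmap.fsubset_leq_card.
by rewrite -fset_set_sub.
Qed.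

Lemma counting_nat_or_inf S : (exists k : nat, counting S = k%:R%:E :> \bar R)
  \/ counting S = +oo%E :> \bar R.
Proof. by rewrite /counting; case: ifPn => _; [left; eexists|right]. Qed.

Lemma counting_ge1 S : (1 <= counting S :> \bar R)%E <-> S !=set0.
Proof.
have [[k kE]|oE] := counting_nat_or_inf S.
  rewrite kE lee_fin ler1n lt0n -(pnatr_eq0 R); split=> [h|/set0P/eqP h].
    by apply/set0P/eqP => /counting_eq0; rewrite kE => -[] /eqP; exact/negP.
  by apply/eqP => k0; apply: h; apply/counting_eq0; rewrite kE k0.
rewrite oE leey; split=> // _; apply/set0P/eqP => /counting_eq0.
by rewrite oE.
Qed.

End counting.

Section events.
Context {R : realType} {d : measure_display} {Omega : measurableType d}.
Variable Pr : probability Omega R.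
Implicit Types (X : Omega -> set (R * R)) (B : set (R * R)).

Definition many_event X B (k : nat) : set Omega :=
  [set w | (k%:R%:E <= counting (X w `&` B) :> \bar R)%E].

Lemma many_eventE X B k :
  many_event X B k = ~` \big[setU/set0]_(i < k) @count_event R d Omega X B i.
Proof.
apply/seteqP; split=> w; rewrite /many_event /= -bigcup_mkord.
  by move=> kw [i /= ik]; rewrite /count_event/= => E; move: kw;
    rewrite E lee_fin ler_nat leqNgt ik.
move=> h; have [[n nE]|->] := @counting_nat_or_inf _ R (X w `&` B); last by rewrite leey.
rewrite nE lee_fin ler_nat leqNgt; apply/negP => nk; apply: h.
by exists n.
Qed.

Lemma hit_eventE X B : many_event X B 1 = ~` @count_event R d Omega X B 0.
Proof. by rewrite many_eventE big_ord_recl big_ord0 setU0. Qed.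

Section poisson_events.
Variables (mu : set (R * R) -> \bar R) (X : Omega -> set (R * R)).
Hypothesis pX : poisson_process Pr mu X.

Lemma measurable_many_event B k : measurable B -> measurable (many_event X B k).
Proof.
move=> mB; rewrite many_eventE; apply: measurableC.
by apply: bigsetU_measurable => i _; exact: (pp_measurable pX).
Qed.

Lemma process_many_event B k : measurable B ->
  process_sigma_algebra X (many_event X B k).
Proof.
move=> mB; rewrite many_eventE /process_sigma_algebra -setTD.
apply: sigma_algebraCD.
rewrite -bigcup_mkord; rewrite bigcup_mkcond.
apply: sigma_algebra_bigcup => i; case: ifPn => _.
  by apply: sub_sigma_algebra; exists B, i.
exact: sigma_algebra0.
Qed.

Lemma prob_count_event B r k : measurable B -> mu B = r%:E -> 0 <= r ->
  Pr (count_event X B k) = (expR (- r) * (r ^+ k / k`!%:R))%:E.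
Proof.
move=> mB mur r0; rewrite (pp_poisson pX) ?mur ?ltry//=.
by rewrite poisson_prob_set1.
Qed.

Lemma prob_many_event B r k : measurable B -> mu B = r%:E -> 0 <= r ->
  Pr (many_event X B k) = (1 - expR (- r) * exp_sum r k)%:E.
Proof.
move=> mB mur r0; rewrite many_eventE probability_setC; last first.
  by apply: bigsetU_measurable => i _; exact: (pp_measurable pX).
rewrite measure_bigsetU//=; last 2 first.
- by move=> i; exact: (pp_measurable pX).
- apply/trivIsetP => i j _ _ ij; apply/seteqP; split=> // w [e1 e2].
  have [/eqP] := etrans (esym e1) e2; rewrite eqr_nat => /eqP ji.
  by move: ij; rewrite ji eqxx.
under eq_bigr do rewrite (prob_count_event _ mB mur r0).
by rewrite sumEFin -EFinB /exp_sum mulr_sumr.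
Qed.

Lemma prob_many_event_le B r j k : measurable B -> mu B = r%:E -> 0 <= r ->
  (0 < j)%N -> (j <= k)%N ->
  (Pr (many_event X B k) <= ((j%:R * r / k%:R) ^+ j)%:E)%E.
Proof.
move=> mB mur r0 j0 jk; rewrite (prob_many_event _ mB mur r0) lee_fin.
rewrite expRN mulrC -[X in X - _](divff (x := expR r)) ?gt_eqF ?expR_gt0//.
rewrite -mulrBl ler_pdivrMr ?expR_gt0//.
exact: exp_sum_tail_le.
Qed.

Lemma prob_many_event_ge B r k : measurable B -> mu B = r%:E ->
  (2 * k)%:R <= r -> ((1 / 2)%:E <= Pr (many_event X B k))%E.
Proof.
move=> mB mur kr; have r0 : 0 <= r by exact: le_trans kr.
rewrite (prob_many_event _ mB mur r0) lee_fin expRN mulrC.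
have : exp_sum r k / expR r <= 1 / 2.
  by rewrite ler_pdivrMr ?expR_gt0// mulrC mulrA mulr1 exp_sum_le_half.
lra.
Qed.

Section hits.
Hypothesis mu0 : mu set0 = 0%E.
Variable n : nat.

(** Interpolates between all boxes empty ([j = 0]) and all boxes hit ([j = n]). *)
Let mixed (B : 'I_n -> set (R * R)) j (i : 'I_n) :=
  if (i < j)%N then many_event X (B i) 1 else count_event X (B i) 0.

(** The axioms of the process give joint probabilities of prescribed counts only, so the boxes are
    switched from empty to hit one at a time: the event with box [i0] hit is the event without a
    condition on [i0] minus the event with [i0] empty, and both have known probabilities by
    induction. *)
Let prob_mixed j : forall (B : 'I_n -> set (R * R)) (r : 'I_n -> R),
  (forall i, measurable (B i)) -> (forall i, mu (B i) = (r i)%:E) ->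
  (forall i, 0 <= r i) -> trivIset setT B ->
  Pr (\bigcap_(i in [set: 'I_n]) mixed B j i) =
  (\prod_(i < n) (if (i < j)%N then 1 - expR (- r i) else expR (- r i)))%:E.
Proof.
have mmixed (B : 'I_n -> set (R * R)) j' i :
    (forall i, measurable (B i)) -> measurable (mixed B j' i).
  move=> mB; rewrite /mixed; case: ifPn => _; first exact: measurable_many_event.
  exact: (pp_measurable pX).
elim: j => [|j ih] B r mB muB r0 tB.
  rewrite /mixed/= (pp_indep pX (fun=> 0%N))// => [|i]; last by rewrite muB ltry.
  rewrite -prodEFin; apply: eq_bigr => i _.
  by rewrite (prob_count_event _ (mB i) (muB i) (r0 i)) expr0 fact0 divr1 mulr1.
have [jn|nj] := ltnP j n; last first.
  have := ih B r mB muB r0 tB; congr (Pr _ = _%:E).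
    apply: eq_bigcapr => i _; rewrite /mixed.
    by rewrite !(leq_trans (ltn_ord i))// ltnW.
  by apply: eq_bigr => i _; rewrite !(leq_trans (ltn_ord i))// ltnW.
pose i0 := Ordinal jn.
(* Emptying the box [i0] removes the constraint on it. *)
pose B' i := if i == i0 then set0 else B i.
pose r' i := if i == i0 then 0 else r i.
have mB' i : measurable (B' i) by rewrite /B'; case: ifPn.
have muB' i : mu (B' i) = (r' i)%:E by rewrite /B' /r'; case: ifPn.
have r'0 i : 0 <= r' i by rewrite /r'; case: ifPn.
have tB' : trivIset setT B'.
  move/trivIsetP: tB => tB; apply/trivIsetP => i i1 _ _ ii1; rewrite /B'.
  by case: ifPn; rewrite ?set0I//; case: ifPn; rewrite ?setI0// => _ _; exact: tB.
have i0E (i : 'I_n) : i != i0 -> (i < j.+1)%N = (i < j)%N.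
  by move=> ii0; rewrite ltnS leq_eqVlt; case: eqP => //= ij; move: ii0;
    rewrite -val_eqE /= ij eqxx.
have mixed0 (i : 'I_n) : i != i0 -> mixed B j.+1 i = mixed B j i.
  by move=> ii0; rewrite /mixed i0E.
have mixed' (i : 'I_n) : i != i0 -> mixed B' j i = mixed B j i.
  by move=> ii0; rewrite /mixed /B' (negbTE ii0).
have E : \bigcap_(i in [set: 'I_n]) mixed B j.+1 i =
    (\bigcap_(i in [set: 'I_n]) mixed B' j i) `\`
    (\bigcap_(i in [set: 'I_n]) mixed B j i).
  apply/seteqP; split=> w.
    move=> h; split.
      move=> i _; have [->|ii0] := eqVneq i i0.
        rewrite /mixed /= ltnn /B' eqxx /count_event/= setI0.
        exact/counting_eq0.
      by rewrite mixed'// -mixed0//; exact: h.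
    move=> /(_ i0 I); have := h i0 I.
    by rewrite /mixed /= ltnSn ltnn hit_eventE.
  move=> [h1 h2] i _; have [->|ii0] := eqVneq i i0.
    rewrite /mixed /= ltnSn hit_eventE => h3; apply: h2 => i1 _.
    have [->|ii0] := eqVneq i1 i0; first by rewrite /mixed/= ltnn.
    by rewrite -mixed'//; exact: h1.
  by rewrite mixed0// -mixed'//; exact: h1.
have mcap (B1 : 'I_n -> set (R * R)) : (forall i, measurable (B1 i)) ->
    measurable (\bigcap_(i in [set: 'I_n]) mixed B1 j i).
  by move=> mB1; apply: fin_bigcap_measurable => // i _; exact: mmixed.
have PD : Pr ((\bigcap_(i in [set: 'I_n]) mixed B' j i) `\`
    (\bigcap_(i in [set: 'I_n]) mixed B j i)) =
    (Pr (\bigcap_(i in [set: 'I_n]) mixed B' j i) -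
     Pr (\bigcap_(i in [set: 'I_n]) mixed B j i))%E.
  rewrite measureD; [|exact: mcap|exact: mcap|].
    rewrite setIidr// => w h i _; have [->|ii0] := eqVneq i i0.
      rewrite /mixed /= ltnn /B' eqxx /count_event/= setI0.
      exact/counting_eq0.
    by rewrite mixed'//; exact: h.
  by apply: le_lt_trans (ltry 1); apply: probability_le1; exact: mcap.
rewrite E PD (ih _ _ mB' muB' r'0 tB') (ih _ _ mB muB r0 tB) -EFinB.
congr (_%:E); rewrite (bigD1 i0)//= [X in _ - X](bigD1 i0)//= [RHS](bigD1 i0)//=.
rewrite !ltnn ltnSn /r' eqxx oppr0 expR0 mul1r.
under eq_bigr => i ii0 do rewrite (negbTE ii0).
under [in RHS]eq_bigr => i ii0 do rewrite i0E//.
by rewrite mulrBl mul1r.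
Qed.

(** Each factor of the exact product is 1 - exp(-r) <= r. This bound by the product of the
    intensities is the substitute for the Mecke formula. *)
Lemma prob_hits_le (B : 'I_n -> set (R * R)) (r : 'I_n -> R) :
  (forall i, measurable (B i)) -> (forall i, mu (B i) = (r i)%:E) ->
  (forall i, 0 <= r i) -> trivIset setT B ->
  (Pr (\bigcap_(i in [set: 'I_n]) many_event X (B i) 1) <= (\prod_(i < n) r i)%:E)%E.
Proof.
move=> mB muB r0 tB; have := prob_mixed n mB muB r0 tB.
rewrite (_ : \bigcap_(i in _) mixed B n i =
    \bigcap_(i in [set: 'I_n]) many_event X (B i) 1); last first.
  by apply: eq_bigcapr => i _; rewrite /mixed ltn_ord.
move=> ->; rewrite lee_fin; apply: ler_prod => i _; rewrite ltn_ord subr_ge0.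
rewrite -expR0 ler_expR oppr_le0 r0/= expR0.
by have := expR_ge1Dx (- r i); lra.
Qed.

End hits.
End poisson_events.
End events.

(** * Sums over the grid *)

Section real_sums.
Context {R : realType}.
Implicit Types (a b c r x z rho eta : R).

(* Tangent inequality for the concave function [x `^ c], from Young's
   inequality applied to [(a / b) `^ c * 1]. *)
Lemma powR_tangent_le a b c : 0 <= a -> 0 < b -> 0 < c < 1 ->
  c * b `^ (c - 1) * (b - a) <= b `^ c - a `^ c.
Proof.
move=> a0 b0 /andP[c0 c1].
have ab0 : 0 <= a / b by rewrite divr_ge0// ltW.
have := @conjugate_powR R ((a / b) `^ c) 1 c^-1 (1 - c)^-1 (powR_ge0 _ _) ler01.
rewrite !invr_gt0 c0 subr_gt0 c1 !invrK => /(_ isT isT).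
rewrite addrC subrK => /(_ erefl).
rewrite powR1 mul1r mulr1 -powRrM divff ?gt_eqF// powRr1// => h.
have -> : a `^ c = b `^ c * (a / b) `^ c.
  by rewrite -(powRM _ (ltW b0) ab0) mulrC divfK// gt_eqF.
have -> : b `^ (c - 1) = b `^ c / b.
  by rewrite powRD ?(gt_eqF b0) ?implybT// powR_inv1// ltW.
have -> : c * (b `^ c / b) * (b - a) = b `^ c - b `^ c * (a / b * c + (1 - c)).
  by field; rewrite gt_eqF.
by rewrite lerD2l lerN2 ler_wpM2l ?powR_ge0.
Qed.

(** A right-endpoint sum of a decreasing function is below the integral of x^(-eta) over [0, 1]. The
    tangent inequality bounds each term by an increment of the primitive x^(1 - eta) / (1 - eta),
    and the increments telescope. *)
Lemma riemann_sum_powR_le n eta : 0 < eta < 1 ->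
  \sum_(j < n.+1) n.+1%:R^-1 * (j.+1%:R / n.+1%:R) `^ (- eta) <= (1 - eta)^-1 :> R.
Proof.
move=> /andP[e0 e1].
have c0 : 0 < 1 - eta by rewrite subr_gt0.
have c1 : 0 < 1 - eta < 1 by rewrite c0/= ltrBlDr ltrDl.
have N0 : (0 : R) < n.+1%:R by [].
pose f (j : nat) : R := (j%:R / n.+1%:R) `^ (1 - eta).
apply: (@le_trans _ _ (\sum_(j < n.+1) (1 - eta)^-1 * (f j.+1 - f j))).
  apply: ler_sum => j _; rewrite [leRHS]mulrC ler_pdivlMr// mulrC.
  have := @powR_tangent_le (j%:R / n.+1%:R) (j.+1%:R / n.+1%:R) (1 - eta).
  rewrite divr_ge0// divr_gt0// => /(_ isT isT c1); apply: le_trans.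
  rewrite -mulrBl -natrB// subSnn mul1r [1 - eta]addrC addrK [_ + 1]addrC -mulrA.
  by rewrite [_ `^ _ * _]mulrC lexx.
rewrite -mulr_sumr.
rewrite -(big_mkord xpredT (fun j => f j.+1 - f j)) telescope_sumr//.
rewrite /f mul0r powR0 ?gt_eqF// subr0 divff ?gt_eqF// powR1 mulr1.
exact: lexx.
Qed.

Lemma sum_indicator_le a b x n : 0 <= x -> b - a + 1 <= x ->
  \sum_(l < n) (a <= l%:R <= b)%R%:R <= x.
Proof.
move=> x0 bax.
(* The alternative strengthens the induction: once [k] itself is counted, the integers left lie
   between [a] and [k], and there are at most [k%:R - a] of them. *)
have h k : forall y, 0 <= y -> (k%:R - a <= y \/ b - a + 1 <= y) ->
  \sum_(l < k) (a <= l%:R <= b)%R%:R <= y :> R.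
  elim: k => [|k ih] y y0 hy; first by rewrite big_ord0.
  rewrite big_ord_recr/=; case: (boolP (a <= k%:R <= b)) => [/andP[ak kb]|_].
    rewrite -[X in _ + X]/(1 : R) -lerBrDr; have hy' : k.+1%:R - a <= y.
      by case: hy => // hy; rewrite -natr1; lra.
    move: hy'; rewrite -natr1 => hy'; apply: ih; first lra.
    by left; lra.
  rewrite addr0; apply: ih => //; case: hy => hy; [left|by right].
  by move: hy; rewrite -natr1; lra.
by apply: h => //; right.
Qed.

End real_sums.

(** The measure of an intersection is the integral of a product of indicators. At each point [z] the
    sum over all tuples then factorizes over the indices; the [m] factors of index other than [ord0]
    are bounded by [M], and the remaining one is integrated. *)
Lemma sum_bigcap_measure_le d (S : measurableType d) (R : realType)
    (mu : {measure set S -> \bar R}) (T : finType) m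
    (c : 'I_m.+1 -> T -> R) (I : T -> set S) (M : R) :
  (forall i t, 0 <= c i t) -> (forall t, measurable (I t)) -> 0 <= M ->
  (forall i z, i != ord0 -> \sum_t c i t * \1_(I t) z <= M) ->
  (\sum_(v : {ffun 'I_m.+1 -> T}) (\prod_i c i (v i))%:E *
     mu (\bigcap_(i in [set: 'I_m.+1]) I (v i))
   <= (M ^+ m)%:E * \sum_t (c ord0 t)%:E * mu (I t))%E.
Proof.
move=> c0 mI M0 hM.
have mcap (v : {ffun 'I_m.+1 -> T}) : measurable (\bigcap_(i in [set: 'I_m.+1]) I (v i)).
  by apply: fin_bigcap_measurable.
have indE (v : {ffun 'I_m.+1 -> T}) z :
  \1_(\bigcap_(i in [set: 'I_m.+1]) I (v i)) z = \prod_i \1_(I (v i)) z :> R.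
  rewrite !indicE; case: (boolP (z \in _)) => [/set_mem h|].
    rewrite big1//= => i _.
    by rewrite indicE mem_set//; exact: h.
  move=> /negP h; apply/esym/eqP/prodf_eq0.
  have [i hi] : exists i, ~ I (v i) z.
    by apply/existsNP => h'; apply: h; apply/mem_set => i _.
  by exists i => //; rewrite indicE memNset.
have mc i : measurable_fun setT (fun z => \sum_t c i t * \1_(I t) z : R).
  apply: measurable_sum => t; apply: measurable_funM => //.
rewrite [leLHS](_ : _ = \int[mu]_z (\prod_i \sum_t c i t * \1_(I t) z)%:E)%E; last first.
  under [RHS]eq_integral => z _.
    rewrite bigA_distr_bigA/= -sumEFin.
    under eq_bigr => v _ do rewrite big_split/= -indE EFinM.
    over.
  rewrite ge0_integral_sum//=; last 2 first.
  - move=> v; apply: emeasurable_funM => //; apply/measurable_EFinP.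
    exact: measurable_indic.
  - by move=> v z _; rewrite mule_ge0 ?lee_fin ?prodr_ge0.
  apply: eq_bigr => v _; rewrite ge0_integralZl_EFin//=; last 2 first.
  - by apply/measurable_EFinP.
  - by apply: prodr_ge0.
  by rewrite integral_indic// setIT.
rewrite [X in (_ <= _ * X)%E](_ : _ = \int[mu]_z (\sum_t c ord0 t * \1_(I t) z)%:E)%E; last first.
  under [RHS]eq_integral => z _.
    rewrite -sumEFin; under eq_bigr do rewrite EFinM.
    over.
  rewrite ge0_integral_sum//=; last 2 first.
  - move=> v; apply: emeasurable_funM => //; apply/measurable_EFinP.
    exact: measurable_indic.
  - by move=> v z _; rewrite mule_ge0 ?lee_fin.
  apply: eq_bigr => v _; rewrite ge0_integralZl_EFin//=; last first.
  - by apply/measurable_EFinP.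
  by rewrite integral_indic// setIT.
rewrite -ge0_integralZl_EFin//=; last 3 first.
- by move=> z _; rewrite lee_fin sumr_ge0// => t _; rewrite mulr_ge0.
- exact/measurable_EFinP.
- exact: exprn_ge0.
apply: ge0_le_lower_integral => z.
  by rewrite lee_fin prodr_ge0// => i _; rewrite sumr_ge0// => t _; rewrite mulr_ge0.
rewrite -EFinM lee_fin (bigD1 ord0)//= mulrC ler_wpM2r//.
  by rewrite sumr_ge0// => t _; rewrite mulr_ge0.
rewrite [leRHS](_ : _ = \prod_(i < m.+1 | i != ord0) M).
  apply: ler_prod => i i0; rewrite hM// andbT.
  by rewrite sumr_ge0// => t _; rewrite mulr_ge0.
by rewrite prodr_const cardC1 card_ord.
Qed.

(** * Volume of the intersection of balls *)

Section ball_measure.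
Context {R : realType}.
Variables (beta gamma gamma' : R).
Implicit Types (p q : R * R).

Lemma measurable_strip : measurable (@strip R).
Proof. by apply: measurableX => //; exact: measurable_itv. Qed.

Lemma measurable_ballF p :
  measurable (ballF beta gamma gamma' p).
Proof.
rewrite (_ : ballF _ _ _ _ = strip `&` (setT `&`
   (fun q => kernelF gamma gamma' p q) @^-1` `]-oo, beta])); last first.
  by apply/seteqP; split=> q /=; rewrite in_itv/=; [move=> [? ?]|move=> [? []]].
apply: measurableI; first exact: measurable_strip.
apply: (_ : measurable_fun setT _) => //; rewrite /kernelF.
apply: measurable_funM; first apply: measurable_funM => //.
- apply: measurableT_comp; first exact: normr_measurable.
  by apply: measurable_funB => //; exact: measurable_fst.
- apply: (measurableT_comp (f := fun x : R => x `^ gamma')).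
    exact: measurable_powR.
  exact: measurable_snd.
Qed.

Lemma measurable_ballF_set n (p : 'I_n -> R * R) :
  measurable (ballF_set beta gamma gamma' (range p)).
Proof.
apply: fin_bigcap_measurable; first exact: finite_image.
by move=> _ [i _ <-]; exact: measurable_ballF.
Qed.

Lemma lebesgue2_rect (I J : set R) : measurable I -> measurable J ->
  ((@lebesgue_measure R \x @lebesgue_measure R) (I `*` J) =
   lebesgue_measure I * lebesgue_measure J)%E.
Proof. by move=> mI mJ; rewrite product_measure1E. Qed.

Lemma strip_measure_rect (I J : set R) : measurable I -> measurable J ->
  (strip_measure (I `*` J) = lebesgue_measure I * lebesgue_measure (J `&` `[0%R, 1%R]%classic))%E.
Proof.
move=> mI mJ; rewrite /strip_measure /strip.
rewrite -setXI setIT product_measure1E//.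
by apply: measurableI => //; exact: measurable_itv.
Qed.

Lemma dyadic_level (w : R) : 0 < w <= 1 ->
  exists b : nat, 2^-1 ^+ b.+1 < w <= 2^-1 ^+ b.
Proof.
move=> /andP[w0 w1].
have : exists b : nat, 2^-1 ^+ b.+1 < w.
  have h : `|2^-1 : R| < 1 by rewrite ger0_norm// invf_lt1// ltr1n.
  have /cvgrPdist_lt/(_ _ w0) := cvg_expr h.
  move=> [n _ /(_ n.+1 (leqnSn n))]; rewrite /= sub0r normrN ger0_norm ?exprn_ge0// => ?.
  by exists n.
move=> hex; have [b hb bmin] := ex_minnP hex; exists b; rewrite hb/=.
case: b hb bmin => [|b] hb bmin; first by rewrite expr0.
by rewrite leNgt; apply/negP => /bmin; rewrite ltnn.
Qed.

(* Bounds the half-width of [ballF (x, u)] at all heights in ]2^-(b+1), 2^-b]. *)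
Definition level_radius (b : nat) (u : R) : R :=
  beta * (2^-1 ^+ b.+1) `^ (- gamma') * u `^ (- gamma).

Definition level_itv (b : nat) p : set R :=
  `[p.1 - level_radius b p.2, p.1 + level_radius b p.2]%classic.

(** The common ball is sliced into dyadic layers of the mark w. On the layer ]2^-(b+1), 2^-b], of
    height 2^-(b+1), the power w^(-gamma') is at most its value at the lower end, so each ball has
    its section in an interval that is the same for the whole layer. *)
Lemma strip_measure_ballF_set_le n (p : 'I_n.+1 -> R * R) :
  0 < gamma' -> (forall i, 0 < (p i).2) ->
  (strip_measure (ballF_set beta gamma gamma' (range p)) <=
   \sum_(0 <= b <oo) (2^-1 ^+ b.+1)%:E * lebesgue_measure
     (\bigcap_(i in [set: 'I_n.+1]) level_itv b (p i)))%E.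
Proof.
move=> g'0 u0.
pose J b := \bigcap_(i in [set: 'I_n.+1]) level_itv b (p i).
have mJ b : measurable (J b).
  by apply: fin_bigcap_measurable => // i _; exact: measurable_itv.
pose S0 : set (R * R) := [set: R] `*` [set 0].
pose S b : set (R * R) := J b `*` `]2^-1 ^+ b.+1, 2^-1 ^+ b]%classic.
have mS0 : measurable S0 by exact: measurableX.
have mS b : measurable (S b) by apply: measurableX => //; exact: measurable_itv.
set B := ballF_set _ _ _ _.
have mB : measurable (B `&` strip).
  by apply: measurableI; [exact: measurable_ballF_set|exact: measurable_strip].
(* The slice at mark 0 lies in no dyadic layer; it gets index 0 and contributes measure 0. *)
pose F b := if b is b'.+1 then S b' else S0.
have mF b : measurable (F b) by case: b.
have BF : B `&` strip `<=` \bigcup_b F b.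
  move=> [z w] [Bq [_ /=]]; rewrite in_itv/= => /andP[w0 w1].
  move: w0; rewrite le_eqVlt => /predU1P[<-|w0]; first by exists 0%N.
  have [|b /andP[bw wb]] := @dyadic_level w; first by rewrite w0.
  exists b.+1 => //; split; last by rewrite /= in_itv/= bw.
  move=> i _; rewrite /level_itv /= in_itv/= -ler_distlC.
  have [_] := Bq (p i) (ex_intro2 _ _ i Logic.I erefl); rewrite /kernelF /= => h.
  rewrite /level_radius [X in _ * X]powRN ler_pdivlMr ?powR_gt0//.
  apply: (@le_trans _ _ (beta * w `^ (- gamma'))).
    by rewrite powRN ler_pdivlMr ?powR_gt0.
  have beta0 : 0 <= beta by apply: le_trans h; rewrite !mulr_ge0 ?powR_ge0.
  rewrite ler_wpM2l// !powRN lef_pV2 ?posrE ?powR_gt0 ?exprn_gt0//.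
  by rewrite ge0_ler_powR ?nnegrE ?exprn_ge0// ltW.
rewrite /strip_measure -/B.
have h := @measure_sigma_subadditive _ R _ (@lebesgue_measure R \x @lebesgue_measure R)%E _ _ mF mB BF.
apply: (le_trans h).
rewrite nneseries_recl// -(@nneseries_addn _ _ 1%N)//.
rewrite [X in (X + _)%E](_ : _ = 0%E); last first.
  transitivity ((@lebesgue_measure R \x @lebesgue_measure R)%E S0) => //.
  by rewrite lebesgue2_rect// lebesgue_measure_set1 mule0.
rewrite add0e.
rewrite le_eqVlt; apply/predU1P; left; apply: eq_eseriesr => b _; rewrite addn1.
have -> : F b.+1 = S b by [].
transitivity ((@lebesgue_measure R \x @lebesgue_measure R)%E (S b)) => //.
rewrite lebesgue2_rect//.
rewrite muleC; congr (_ * _)%E.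
rewrite lebesgue_measure_itv/= lte_fin exprS gtr_pMl ?exprn_gt0//.
rewrite invf_lt1// ltr1n/= -EFinB; congr (_%:E). by field.
Qed.

End ball_measure.

(** * Sums of common ball volumes over tuples of grid cells *)

Section grid_sums.
Context {R : realType}.

Let one_powR (a : R) : 1 = 1 `^ a :> R.
Proof. by rewrite powR1. Qed.

Lemma sum_dyadic_powR_le (delta c : R) : 0 < delta -> 0 <= c ->
  (\sum_(0 <= b <oo) (c * (2^-1 ^+ b.+1) `^ delta)%:E <=
   (c / (1 - 2^-1 `^ delta))%:E)%E.
Proof.
move=> d0 c0; set q := 2^-1 `^ delta.
have q0 : 0 < q by rewrite powR_gt0.
have q1 : q < 1.
  rewrite /q [ltRHS](one_powR delta) gt0_ltr_powR ?nnegrE ?invr_ge0//.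
  by rewrite invf_lt1// ltr1n.
have wE b : (2^-1 ^+ b.+1) `^ delta = q ^+ b.+1.
  rewrite -[2^-1 ^+ b.+1]powR_mulrn ?invr_ge0// -powRrM mulrC powRrM powR_mulrn//.
apply: lime_le; first by apply: is_cvg_nneseries => b _ _;
  rewrite lee_fin mulr_ge0 ?powR_ge0.
near=> n; rewrite /eseries/= sumEFin lee_fin.
under eq_bigr do rewrite wE.
apply: (@le_trans _ _ (series (geometric c q) n)).
  rewrite /series/=; apply: ler_sum => b _; rewrite ler_wpM2l//.
  by rewrite exprS ler_piMl ?exprn_ge0// ltW.
by apply: geometric_le_lim => //; rewrite ger0_norm// ltW.
Unshelve. all: by end_near. Qed.

Variables (beta gamma gamma' : R).
Hypotheses (beta_gt0 : 0 < beta) (gamma_gt0 : 0 < gamma).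
Hypotheses (gamma'_gt0 : 0 < gamma').

Lemma level_radius_ge0 b u : 0 <= level_radius beta gamma gamma' b u.
Proof. by rewrite /level_radius !mulr_ge0 ?powR_ge0// ltW. Qed.

Lemma lebesgue_level_itv b (p : R * R) :
  lebesgue_measure (level_itv beta gamma gamma' b p) =
  (2 * level_radius beta gamma gamma' b p.2)%:E.
Proof.
rewrite /level_itv lebesgue_measure_itv/= lte_fin.
set r := level_radius _ _ _ _ _; have r0 : 0 <= r by exact: level_radius_ge0.
case: ifPn => [_|]; first by rewrite -EFinB; congr (_%:E); ring.
by rewrite -leNgt => h; congr (_%:E); lra.
Qed.

(** Only the interval of vertex [i] is kept in each layer; with w = 2^-(b+1) the layers contribute
    multiples of w^(1 - gamma'), a convergent geometric series. *)
Lemma strip_measure_ballF_set_single_le n (p : 'I_n.+1 -> R * R) i :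
  gamma' < 1 -> (forall i, 0 < (p i).2) ->
  (strip_measure (ballF_set beta gamma gamma' (range p)) <=
    ((2 * beta / (1 - 2^-1 `^ (1 - gamma'))) * (p i).2 `^ (- gamma))%:E)%E.
Proof.
move=> g'1 p0.
apply: (le_trans (strip_measure_ballF_set_le _ _ gamma'_gt0 p0)).
have d0 : 0 < 1 - gamma' by rewrite subr_gt0.
have c0 : 0 <= 2 * beta * (p i).2 `^ (- gamma).
  by rewrite !mulr_ge0 ?powR_ge0// ltW.
rewrite [X in (_ <= X%:E)%E]mulrAC.
apply: le_trans (sum_dyadic_powR_le d0 c0).
apply: lee_nneseries => [b _|b _]; first by rewrite mule_ge0// lee_fin exprn_ge0.
set w : R := 2^-1 ^+ b.+1.
have w0 : 0 < w by rewrite exprn_gt0.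
apply: (@le_trans _ _ (w%:E * lebesgue_measure (level_itv beta gamma gamma' b (p i)))%E).
  rewrite lee_wpmul2l ?lee_fin ?(ltW w0)//; apply: le_measure.
  - by rewrite inE; apply: fin_bigcap_measurable => // ? _; exact: measurable_itv.
  - by rewrite inE; exact: measurable_itv.
  - by move=> z; exact.
rewrite lebesgue_level_itv -EFinM lee_fin /level_radius -/w.
rewrite powRD ?(gt_eqF w0) ?implybT// powRr1 ?(ltW w0)//.
by rewrite le_eqVlt; apply/predU1P; left; ring.
Qed.

Variable n : nat.
Notation N := n.+1.

(** Indices of the square cells of side 1/N: the first one is for locations, from -N to N, the
    second one for marks. *)
Definition grid := ('I_(2 * N ^ 2) * 'I_N)%type.

Definition grid_loc (l : nat) : R := l%:R / N%:R - N%:R.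
(* The lowest layer of cells starts at mark 1/N, away from the singularity at
   mark 0; a point of positive mark is covered once N is large. *)
Definition grid_mark (j : nat) : R := j.+1%:R / N%:R.
Definition grid_corner (t : grid) : R * R := (grid_loc t.1, grid_mark t.2).

Lemma grid_mark_gt0 j : 0 < grid_mark j.
Proof. by rewrite divr_gt0. Qed.

Lemma grid_mark_le1 (j : 'I_N) : grid_mark j <= 1.
Proof. by rewrite ler_pdivrMr// mul1r ler_nat. Qed.

Variables (m : nat) (kappa : R) (alpha : nat -> R).
Hypotheses (kappa_ge0 : 0 <= kappa) (kappa_lt : gamma + kappa < 1).
Hypotheses (alpha_ge0 : forall l, 0 <= alpha l)
  (alpha_le1 : \sum_(l < 2 * N ^ 2) alpha l <= 1).

(** A discretized measure with density u^(-kappa) in the mark. Index [ord0] stands for the center,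
    whose location is confined to [A]: there [alpha l] is meant to be the mass of [A] in column [l]
    instead of the full width 1/N. *)
Definition grid_weight (i : 'I_m.+1) (t : grid) : R :=
  (if i == ord0 then alpha t.1 else N%:R^-1) * N%:R^-1 * grid_mark t.2 `^ (- kappa).

Lemma grid_weight_ge0 i t : 0 <= grid_weight i t.
Proof.
rewrite /grid_weight !mulr_ge0 ?powR_ge0 ?invr_ge0//.
by case: ifPn; rewrite ?invr_ge0.
Qed.

(** [rho b] is the level radius at mark 1, and [S] below is the integral of u^(-(gamma + kappa))
    over [0, 1]. *)
Let rho b : R := beta * (2^-1 ^+ b.+1) `^ (- gamma').
Let S : R := (1 - (gamma + kappa))^-1.

Let rho_ge b : beta <= rho b.
Proof.
rewrite /rho ler_peMr ?(ltW beta_gt0)// powRN invf_ge1 ?powR_gt0 ?exprn_gt0//.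
rewrite [leRHS](one_powR gamma') ge0_ler_powR ?nnegrE ?exprn_ge0// ?(ltW gamma'_gt0)//.
by rewrite exprn_ile1// invf_le1// ler1n.
Qed.

Let S_ge0 : 0 <= S.
Proof. by rewrite invr_ge0 subr_ge0 ltW. Qed.

Let K_ge0 : 0 <= 2 + beta^-1.
Proof. by rewrite addr_ge0 ?invr_ge0 ?(ltW beta_gt0). Qed.

Let mark_sum_le :
  \sum_(j < N) N%:R^-1 * grid_mark j `^ (- (gamma + kappa)) <= S.
Proof.
by apply: riemann_sum_powR_le; rewrite kappa_lt andbT ltr_wpDr.
Qed.

Let mark_powD (j : 'I_N) : grid_mark j `^ (- (gamma + kappa)) =
  grid_mark j `^ (- gamma) * grid_mark j `^ (- kappa).
Proof.
by rewrite opprD powRD// (gt_eqF (grid_mark_gt0 _)) implybT.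
Qed.

(** For a fixed mark, the grid locations whose interval contains [z] fill an interval of length 2r,
    which has at most 2rN + 1 of them. Summing r u^(-kappa) over the marks produces the singularity
    u^(-(gamma + kappa)), controlled by [S]. *)
Let section_le b (i : 'I_m.+1) z : i != ord0 ->
  \sum_t grid_weight i t * \1_(level_itv beta gamma gamma' b (grid_corner t)) z
  <= (2 + beta^-1) * rho b * S.
Proof.
move=> i0.
rewrite -(pair_bigA _ (fun l j => grid_weight i (l, j) *
  \1_(level_itv beta gamma gamma' b (grid_corner (l, j))) z))/= exchange_big/=.
apply: le_trans (_ : (2 + beta^-1) * rho b * (\sum_(j < N) N%:R^-1 * grid_mark j `^ (- (gamma + kappa))) <= _); last first.
  by rewrite ler_wpM2l// mulr_ge0 ?addr_ge0 ?invr_ge0 ?(ltW beta_gt0)// (le_trans _ (rho_ge b))// ltW.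
rewrite mulr_sumr; apply: ler_sum => j _.
rewrite /grid_weight (negbTE i0)/=.
set u := grid_mark j; set r := rho b * u `^ (- gamma).
have u0 : 0 < u by exact: grid_mark_gt0.
have r0 : 0 <= r by rewrite mulr_ge0 ?powR_ge0// (le_trans _ (rho_ge b))// ltW.
have N0 : (0 : R) < N%:R by [].
have swap_itv (y M : R) :
  (y - M - r <= z <= y - M + r) = (z + M - r <= y <= z + M + r).
  by apply/idP/idP => /andP[h1 h2]; apply/andP; split; lra.
have indE (l : 'I_(2 * N ^ 2)) :
  \1_(level_itv beta gamma gamma' b (grid_corner (l, j))) z =
  ((z + N%:R - r) * N%:R <= l%:R <= (z + N%:R + r) * N%:R)%R%:R :> R.
  rewrite indicE; congr (nat_of_bool _)%:R.
  rewrite /level_itv mem_setE in_itv/= /grid_loc.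
  rewrite (_ : level_radius _ _ _ _ _ = r)//.
  rewrite -[((_ - r) * _ <= _)]ler_pdivlMr// -[(_ <= (_ + r) * _)]ler_pdivrMr//.
under eq_bigr do rewrite indE.
rewrite -mulr_sumr.
have := @sum_indicator_le R ((z + N%:R - r) * N%:R) ((z + N%:R + r) * N%:R)
  (2 * r * N%:R + 1) (2 * N ^ 2).
have x0 : 0 <= 2 * r * N%:R + 1 by rewrite addr_ge0// mulr_ge0// mulr_ge0.
move=> /(_ x0) h.
apply: (@le_trans _ _ (N%:R^-1 * N%:R^-1 * u `^ (- kappa) * (2 * r * N%:R + 1))).
  rewrite ler_wpM2l//; first by rewrite !mulr_ge0 ?powR_ge0 ?invr_ge0.
  by apply: h; lra.
rewrite mark_powD -/u.
(* The radius is at least [beta], so the extra grid point is absorbed in a multiple of the radius;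
   this is where the constant [2 + beta^-1] comes from. *)
have ru : 1 <= beta^-1 * r.
  rewrite ler_pdivlMl// mulr1; apply: (le_trans (rho_ge b)).
  rewrite /r ler_peMr ?(le_trans _ (rho_ge b)) ?(ltW beta_gt0)//.
  rewrite powRN invf_ge1 ?powR_gt0// [leRHS](one_powR gamma).
  by rewrite ge0_ler_powR ?nnegrE ?(ltW u0) ?(ltW gamma_gt0)// grid_mark_le1.
rewrite [leRHS](_ : _ = N%:R^-1 * N%:R^-1 * u `^ (- kappa) * ((2 * r + beta^-1 * r) * N%:R)).
  rewrite ler_wpM2l//; first by rewrite !mulr_ge0 ?powR_ge0 ?invr_ge0.
  rewrite [leRHS]mulrDl lerD2l; apply: (le_trans ru).
  by rewrite ler_peMr ?ler1n// (le_trans _ ru).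
by rewrite /r; field; rewrite gt_eqF//= gt_eqF.
Qed.

(** The locations contribute the total mass of [alpha], at most 1, and the interval lengths a factor
    2, weakened to [2 + beta^-1] to match [section_le]. *)
Let total_le b :
  (\sum_t (grid_weight ord0 t)%:E *
     lebesgue_measure (level_itv beta gamma gamma' b (grid_corner t))
   <= ((2 + beta^-1) * rho b * S)%:E)%E.
Proof.
under eq_bigr do rewrite lebesgue_level_itv -EFinM.
rewrite sumEFin lee_fin.
rewrite -(pair_bigA _ (fun l j => grid_weight ord0 (l, j) *
  (2 * level_radius beta gamma gamma' b (grid_corner (l, j)).2)))/=.
rewrite (_ : \sum_(i < _) _ = (\sum_(l < 2 * N ^ 2) alpha l) * (2 * rho b *
    \sum_(j < N) N%:R^-1 * grid_mark j `^ (- (gamma + kappa)))); last first.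
  rewrite mulr_suml; apply: eq_bigr => l _.
  rewrite 2!mulr_sumr; apply: eq_bigr => j _.
  rewrite /grid_weight eqxx/= mark_powD /level_radius -/(rho b); ring.
have rho0 : 0 <= rho b by rewrite (le_trans _ (rho_ge b))// ltW.
apply: (@le_trans _ _ (1 * (2 * rho b * S))).
  apply: ler_pM => //; first exact: sumr_ge0.
    apply: mulr_ge0; first exact: mulr_ge0.
    by apply: sumr_ge0 => j _; rewrite mulr_ge0 ?powR_ge0 ?invr_ge0.
  by rewrite ler_wpM2l// mulr_ge0.
rewrite mul1r ler_wpM2r// ler_wpM2r// lerDl invr_ge0 ltW//.
Qed.

Definition grid_const : R :=
  ((2 + beta^-1) * beta * S) ^+ m.+1 / (1 - 2^-1 `^ (1 - gamma' * m.+1%:R)).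

(** In the layer with w = 2^-(b+1) each of the m + 1 vertices contributes a factor of order
    w^(-gamma'), and the height contributes w. The resulting series of w^(1 - gamma' (m + 1))
    converges because of the bound on [gamma']. *)
Lemma sum_grid_measure_le : gamma' * m.+1%:R < 1 ->
  (\sum_(v : {ffun 'I_m.+1 -> grid}) (\prod_i grid_weight i (v i))%:E *
    strip_measure (ballF_set beta gamma gamma' (range (grid_corner \o v)))
   <= grid_const%:E)%E.
Proof.
move=> g'm.
have d0 : 0 < 1 - gamma' * m.+1%:R by rewrite subr_gt0.
have c0 : 0 <= ((2 + beta^-1) * beta * S) ^+ m.+1.
  by apply: exprn_ge0; apply: mulr_ge0 => //; apply: mulr_ge0 => //; exact: ltW.
apply: le_trans (sum_dyadic_powR_le d0 c0).
pose L b (v : {ffun 'I_m.+1 -> grid}) :=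
  (lebesgue_measure (\bigcap_(i in [set: 'I_m.+1])
    level_itv beta gamma gamma' b (grid_corner (v i))))%E.
apply: (@le_trans _ _ (\sum_(v : {ffun 'I_m.+1 -> grid})
  \sum_(0 <= b <oo) (\prod_i grid_weight i (v i))%:E * ((2^-1 ^+ b.+1)%:E * L b v))%E).
  apply: lee_sum => v _; rewrite nneseriesZl; last first.
    by move=> b _; rewrite mule_ge0// lee_fin exprn_ge0.
  rewrite lee_wpmul2l//; first by rewrite lee_fin prodr_ge0// => i _; exact: grid_weight_ge0.
  by apply: strip_measure_ballF_set_le => // i; exact: grid_mark_gt0.
have w0 (v : {ffun 'I_m.+1 -> grid}) : (0 <= (\prod_i grid_weight i (v i))%:E)%E.
  by rewrite lee_fin prodr_ge0// => i _; exact: grid_weight_ge0.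
rewrite -nneseries_sum; last first.
  by move=> v b _; rewrite !mule_ge0// lee_fin exprn_ge0.
apply: lee_nneseries => [b _ _|b _].
  by apply: sume_ge0 => v _; rewrite !mule_ge0// lee_fin exprn_ge0.
under eq_bigr do rewrite muleCA.
rewrite -ge0_sume_distrr; last by move=> v _; rewrite mule_ge0.
set w : R := 2^-1 ^+ b.+1.
have w0' : 0 < w by rewrite exprn_gt0.
have rho0 : 0 <= rho b by rewrite (le_trans _ (rho_ge b))// ltW.
have M0 : 0 <= (2 + beta^-1) * rho b * S.
  by apply: mulr_ge0 => //; exact: mulr_ge0.
apply: (@le_trans _ _ (w%:E * (((2 + beta^-1) * rho b * S) ^+ m.+1)%:E)%E).
  rewrite lee_wpmul2l ?lee_fin ?(ltW w0')//.
  have h := @sum_bigcap_measure_le _ _ R (@lebesgue_measure R) _ m grid_weight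
    (fun t => level_itv beta gamma gamma' b (grid_corner t)) _ grid_weight_ge0
    (fun t => measurable_itv _) M0 (fun i z => @section_le b i z).
  apply: (le_trans h).
  rewrite exprSr EFinM; apply: lee_wpmul2l; last exact: total_le.
  by rewrite lee_fin exprn_ge0.
rewrite -EFinM lee_fin /rho -/w powRD ?(gt_eqF w0') ?implybT// powRr1 ?(ltW w0')//.
rewrite -mulNr powRrM powR_mulrn ?powR_ge0// !exprMn le_eqVlt; apply/predU1P; left.
ring.
Qed.

End grid_sums.

(** * Grid cells *)

Section grid_cells.
Context {R : realType}.
Implicit Types (q : R * R).

Definition grid_cell n (t : grid n) : set (R * R) :=
  `[grid_loc n t.1, grid_loc n t.1 + n.+1%:R^-1[%classic `*`
  `[grid_mark n t.2, grid_mark n t.2 + n.+1%:R^-1[%classic.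

Lemma grid_cell_exists n q : `|q.1| < n.+1%:R -> n.+1%:R^-1 <= q.2 -> q.2 <= 1 ->
  exists t, @grid_cell n t q.
Proof.
move=> q1 q20 q21; set M : R := n.+1%:R; have M0 : 0 < M by [].
move: q1; rewrite ltr_norml => /andP[q1l q1r].
have xM0 : 0 <= (q.1 + M) * M by rewrite mulr_ge0// ?(ltW M0)// -lerBlDr sub0r ltW.
have uM0 : 0 <= q.2 * M by rewrite mulr_ge0// ?(ltW M0)// (le_trans _ q20).
have /andP[l1 l2] := truncn_itv xM0.
have /andP[j1 j2] := truncn_itv uM0.
set l := Num.truncn _ in l1 l2; set j := Num.truncn _ in j1 j2.
have lb : (l < 2 * n.+1 ^ 2)%N.
  rewrite -(ltr_nat R) (le_lt_trans l1)// natrM natrX -/M expr2 mulrA ltr_pM2r//.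
  by rewrite mulr_natl mulr2n ltrD2r.
(* The layer of index i starts at mark (i + 1) / N, hence the index [j.-1] for the point. *)
have j0 : (0 < j)%N.
  rewrite -ltnS -(ltr_nat R) (le_lt_trans _ j2)//.
  by move: q20; rewrite -/M -ler_pdivrMr// mul1r.
have jb : (j.-1 < n.+1)%N.
  by rewrite prednK// -(ler_nat R) (le_trans j1)// -/M ler_piMl// ltW.
exists (Ordinal lb, Ordinal jb); split; rewrite /= in_itv/=.
  rewrite /grid_loc -/M lerBlDr ler_pdivrMr// l1/=.
  have -> : l%:R / M - M + M^-1 = l.+1%:R / M - M by rewrite -natr1 mulrDl mul1r addrAC.
  by rewrite ltrBrDr ltr_pdivlMr.
rewrite /grid_mark -/M prednK// ler_pdivrMr// j1/=.
have -> : j%:R / M + M^-1 = j.+1%:R / M by rewrite -natr1 mulrDl mul1r.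
by rewrite ltr_pdivlMr.
Qed.

Lemma grid_cell_dist n (t : grid n) q q' : grid_cell t q -> grid_cell t q' ->
  `|q.1 - q'.1| < n.+1%:R^-1 /\ `|q.2 - q'.2| < n.+1%:R^-1.
Proof.
rewrite /grid_cell; move: (grid_loc n t.1) (grid_mark n t.2) (n.+1%:R^-1 : R) => x u r.
move=> [] + + [] + +; rewrite /= !in_itv/=.
move=> /andP[a b] /andP[c e] /andP[a' b'] /andP[c' e'].
by split; rewrite ltr_norml; apply/andP; split; lra.
Qed.

Lemma near_inv_natS_lt (e : R) : 0 < e -> \forall n \near \oo, n.+1%:R^-1 < e.
Proof. by move=> e0; exact: near_infty_natSinv_lt (PosNum e0). Qed.

Lemma near_grid_cell_exists q : 0 < q.2 <= 1 ->
  \forall n \near \oo, exists t, @grid_cell n t q.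
Proof.
move=> /andP[q0 q1]; near=> n; apply: grid_cell_exists => //.
  have : `|q.1| < n%:R.
    by near: n; exact: nbhs_infty_gtr.
  by move=> /lt_le_trans; apply; rewrite ler_nat.
by apply: ltW; near: n; exact: near_inv_natS_lt.
Unshelve. all: by end_near. Qed.

Lemma near_grid_cell_separated q q' : q <> q' ->
  \forall n \near \oo, forall t, @grid_cell n t q -> grid_cell t q' -> False.
Proof.
move=> qq'.
have [h|h] : q.1 <> q'.1 \/ q.2 <> q'.2.
- apply: contrapT => /not_orP[/contrapT a /contrapT b]; apply: qq'.
  by rewrite (surjective_pairing q) (surjective_pairing q') a b.
- have h0 : 0 < `|q.1 - q'.1| by rewrite normr_gt0 subr_eq0; exact/eqP.
  near=> n; move=> t tq tq'; have [/lt_trans + _] := grid_cell_dist tq tq'.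
  suff nh : n.+1%:R^-1 < `|q.1 - q'.1| by move=> /(_ _ nh); rewrite ltxx.
  by near: n; exact: near_inv_natS_lt.
- have h0 : 0 < `|q.2 - q'.2| by rewrite normr_gt0 subr_eq0; exact/eqP.
  near=> n; move=> t tq tq'; have [_ /lt_trans +] := grid_cell_dist tq tq'.
  suff nh : n.+1%:R^-1 < `|q.2 - q'.2| by move=> /(_ _ nh); rewrite ltxx.
  by near: n; exact: near_inv_natS_lt.
Unshelve. all: by end_near. Qed.

Lemma near_forall_seq (T : eqType) (s : seq T) (P : T -> nat -> Prop) :
  (forall x, x \in s -> \forall n \near \oo, P x n) ->
  \forall n \near \oo, forall x, x \in s -> P x n.
Proof.
elim: s => [_|a s ih h]; first by apply: nearW.
have h1 := h a (mem_head _ _).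
have /ih h2 : forall x, x \in s -> \forall n \near \oo, P x n.
  by move=> x xs; apply: h; rewrite inE xs orbT.
by apply: filterS2 h1 h2 => n Pa Ps x; rewrite inE => /predU1P[->|/Ps].
Qed.

(** Passing from [q] to the corner of its cell lowers the mark, which lowers the kernel, and moves
    the location by at most 1/N <= 1, which adds at most 1 because both mark powers are at most
    1. *)
Lemma ballF_grid_corner beta (gamma gamma' : R) n (t : grid n) q :
  0 < gamma -> 0 < gamma' -> grid_cell t q -> q.2 <= 1 ->
  ballF beta gamma gamma' q `<=` ballF (beta + 1) gamma gamma' (grid_corner t).
Proof.
move=> g0 g'0 [] + +; rewrite /= !in_itv/= => /andP[a b] /andP[c e] q1 z [sz].
rewrite /kernelF => h; split=> //; rewrite /kernelF/=.
case: (sz) => _ /=; rewrite in_itv/= => /andP[w0 w1].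
set x := grid_loc n t.1 in a b *; set u := grid_mark n t.2 in c e *.
have u0 : 0 < u by exact: grid_mark_gt0.
have uq : u `^ gamma <= q.2 `^ gamma.
  by rewrite ge0_ler_powR ?nnegrE ?(ltW g0)// ?(ltW u0)// (le_trans (ltW u0)).
have q1' : q.2 `^ gamma <= 1.
  have -> : 1 = 1 `^ gamma :> R by rewrite powR1.
  by rewrite ge0_ler_powR ?nnegrE ?(ltW g0)// (le_trans (ltW u0)).
have w1' : z.2 `^ gamma' <= 1.
  have -> : 1 = 1 `^ gamma' :> R by rewrite powR1.
  by rewrite ge0_ler_powR ?nnegrE ?(ltW g'0).
apply: (@le_trans _ _ ((`|q.1 - z.1| + 1) * q.2 `^ gamma * z.2 `^ gamma')).
  rewrite ler_wpM2r ?powR_ge0// ler_pM ?powR_ge0//.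
  have -> : x - z.1 = (q.1 - z.1) + (x - q.1) by ring.
  rewrite (le_trans (ler_normD _ _))// lerD2l ler_norml.
  have : n.+1%:R^-1 <= 1 :> R by rewrite invf_le1// ler1n.
  by move: (n.+1%:R^-1 : R) b a => N b a hN; apply/andP; split; lra.
rewrite -mulrA mulrDl mul1r mulrA lerD// -[leRHS]mulr1.
by rewrite ler_pM ?powR_ge0.
Qed.

End grid_cells.

(** * Simplices and grid configurations *)

Section simplex_enumeration.
Context {R : realType}.
Implicit Types (D : set (R * R)).

Lemma exists_center_vertex n (p : 'I_n.+1 -> R * R) :
  exists i, is_center_vertex (range p) (p i).
Proof.
pose i1 := [arg min_(i < ord0) (p i).2]%O.
have h1 j : (p i1).2 <= (p j).2.
  by rewrite /i1; case: arg_minP => // i _ /(_ j); apply.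
pose i2 := [arg min_(i < i1 | (p i).2 == (p i1).2) (p i).1]%O.
have [h2 h3] : (p i2).2 = (p i1).2 /\
    forall j, (p j).2 = (p i1).2 -> (p i2).1 <= (p j).1.
  rewrite /i2; case: arg_minP => // i /eqP ii h; split=> // j jj.
  by apply: h; apply/eqP.
exists i2; split; first by exists i2.
move=> _ [j _ <-]; rewrite h2; have := h1 j; rewrite le_eqVlt => /predU1P[E|]; last by left.
by right; split=> //; exact: h3.
Qed.

Lemma center_vertexE D (q : R * R) : is_center_vertex D q -> Defs.center D = q.1.
Proof.
move=> hq; have [Dq hmin] := hq; rewrite /Defs.center.
case: xgetP => [p _ [Dp hp]|/(_ q)//].
have [a|[_ a]] := hmin _ Dp; have [b|[E b]] := hp _ Dq.
- by move: (lt_trans a b); rewrite ltxx.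
- by move: a; rewrite E ltxx.
- by move: b; case: (hmin _ Dp) => [c|[c _]] b; [move: (lt_trans c b)|move: b; rewrite c]; rewrite ltxx.
- by apply/eqP; rewrite eq_le a b.
Qed.

(** A transposition brings the center to index 0, so that the condition on its location concerns the
    cell of index 0 only. *)
Lemma simplex_enumeration D m : (D #= `I_m.+1)%card ->
  exists p : 'I_m.+1 -> R * R,
    [/\ injective p, range p = D & (p ord0).1 = Defs.center D].
Proof.
rewrite card_eq_sym => /card_set_bijP[f [fun_f inj_f surj_f]].
pose p (i : 'I_m.+1) := f i.
have p_inj : injective p.
  by move=> i j ij; apply/val_inj; apply: inj_f => //; rewrite inE /=; exact: ltn_ord.
have pD : range p = D.
  apply/seteqP; split=> [_ [i _ <-]|q /surj_f[i /= im <-]].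
    by apply: fun_f; exact: (ltn_ord i).
  by exists (Ordinal im).
have [i1 hi1] := exists_center_vertex p.
exists (p \o tperm ord0 i1); split.
- by apply: inj_comp => //; exact: perm_inj.
- rewrite -pD; apply/seteqP; split=> [_ [i _ <-]|_ [i _ <-]].
    by exists (tperm ord0 i1 i).
  by exists (tperm ord0 i1 i) => //=; rewrite tpermK.
- by rewrite /= tpermL -pD; apply/esym/center_vertexE.
Qed.

End simplex_enumeration.

Section pointwise.
Context {R : realType}.
Variables (beta gamma gamma' : R) (m : nat) (A : set R).
Implicit Types (X Y D : set (R * R)).

Definition simplices_deg k X Y : set (set (R * R)) :=
  [set D | simplices_in beta gamma gamma' m A X Y D /\
    (k%:R%:E <= degree beta gamma gamma' Y D :> \bar R)%E].

Definition marked_cell n (i : 'I_m.+1) (t : grid n) : set (R * R) :=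
  (if i == ord0 then A else setT) `*` setT `&` grid_cell t.

(** The radius [beta + 1] makes this set contain the common ball of any points of the strip chosen
    in the cells; it depends on the cells only, so its count of Y-points has a Poisson law. *)
Definition cover_ball n (v : {ffun 'I_m.+1 -> grid n}) : set (R * R) :=
  ballF_set (beta + 1) gamma gamma' (range (fun i => grid_corner (v i))).

Definition grid_config k X Y n (v : {ffun 'I_m.+1 -> grid n}) : Prop :=
  (forall i, X `&` marked_cell i (v i) !=set0) /\
  (k%:R%:E <= counting (Y `&` cover_ball v) :> \bar R)%E.

Hypotheses (gamma_gt0 : 0 < gamma) (gamma'_gt0 : 0 < gamma').

(** Only finitely many vertices occur in [F]. For large [n] each of them lies in a cell, as its mark
    is positive, and distinct ones lie in distinct cells. A simplex is then determined by its tuple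
    of cells, so sending it to that tuple is injective. *)
Lemma near_card_simplices_deg_le k X Y (F : seq (set (R * R))) :
  X `<=` strip -> X `&` ([set: R] `*` [set 0]) = set0 ->
  uniq F -> (forall D, D \in F -> simplices_deg k X Y D) ->
  \forall n \near \oo, (size F <=
    #|[pred v : {ffun 'I_m.+1 -> grid n} | injectiveb v && `[< grid_config k X Y v >]]|)%N.
Proof.
move=> Xstrip X0 uF hF.
have [pD hpD] : {pD : set (R * R) -> 'I_m.+1 -> R * R & forall D, D \in F ->
    [/\ injective (pD D), range (pD D) = D & (pD D ord0).1 = Defs.center D]}.
  apply: (choice (P := fun D p => D \in F ->
    [/\ injective p, range p = D & (p ord0).1 = Defs.center D])) => D.
  have [/hF[[[_ /simplex_enumeration[p hp] _] _] _]|_] := boolP (D \in F).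
    by exists p.
  by exists (fun=> (0, 0)).
(* All vertices of all simplices of [F]. *)
pose P := flatten [seq [seq pD D i | i <- enum 'I_m.+1] | D <- F].
have PP D i : D \in F -> pD D i \in P.
  move=> DF; apply/flattenP; exists [seq pD D i | i <- enum 'I_m.+1].
    by apply/mapP; exists D.
  by apply/mapP; exists i => //; rewrite mem_enum.
have DD D i : D \in F -> D (pD D i).
  move=> /hpD[_ rD _]; have : range (pD D) (pD D i) by exists i.
  by rewrite rD.
have XP q : q \in P -> X q.
  move=> /flattenP[_ /mapP[D DF ->] /mapP[i _ ->]].
  by have [[[DX _ _] _] _] := hF _ DF; apply: DX; exact: DD.
have P01 q : q \in P -> 0 < q.2 <= 1.
  move=> /XP Xq; have [_ /=] := Xstrip _ Xq; rewrite in_itv/= => /andP[q0 ->].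
  rewrite andbT lt_neqAle q0 andbT; apply/eqP => q0'.
  have : (X `&` ([set: R] `*` [set 0])) q by split=> //; split.
  by rewrite X0.
have n1 : \forall n \near \oo, forall q, q \in P -> exists t, @grid_cell R n t q.
  apply: (near_forall_seq (P := fun q n => exists t, @grid_cell R n t q)) => q /P01.
  exact: near_grid_cell_exists.
have n2 : \forall n \near \oo, forall qq, qq \in [seq (q, q') | q <- P, q' <- P] ->
    qq.1 <> qq.2 -> forall t, @grid_cell R n t qq.1 -> grid_cell t qq.2 -> False.
  apply: (near_forall_seq (P := fun qq n => qq.1 <> qq.2 ->
    forall t, @grid_cell R n t qq.1 -> grid_cell t qq.2 -> False)) => -[q q'] _ /=.
  have [->|/eqP qq'] := eqVneq q q'; first by apply: nearW.
  by apply: filterS (near_grid_cell_separated qq') => n h _; exact: h.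
apply: filterS2 n1 n2 => n h1 h2.
have t0 : grid n.
  by split; [apply: (@Ordinal _ 0); rewrite muln_gt0 expn_gt0|exact: ord0].
have [t ht] : {t : R * R -> grid n & forall q, q \in P -> grid_cell (t q) q}.
  apply: (choice (P := fun q t => q \in P -> grid_cell t q)) => q.
  have [/h1[t tq]|_] := boolP (q \in P); first by exists t.
  by exists t0.
have t_inj q q' : q \in P -> q' \in P -> t q = t q' -> q = q'.
  move=> Pq Pq' tt; apply: contrapT => qq'.
  have qqP : (q, q') \in [seq (q, q') | q <- P, q' <- P].
    by apply/allpairsP; exists (q, q').
  by apply: (h2 _ qqP qq' (t q)) => /=; [exact: ht|rewrite tt; exact: ht].
pose v D : {ffun 'I_m.+1 -> grid n} := [ffun i => t (pD D i)].
rewrite -(size_map v) cardE; apply: uniq_leq_size.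
  rewrite map_inj_in_uniq// => D D' DF D'F /ffunP vv.
  have [_ rD _] := hpD _ DF; have [_ rD' _] := hpD _ D'F; rewrite -rD -rD'.
  suff pp : pD D =1 pD D' by rewrite (funext pp).
  by move=> i; have := vv i; rewrite !ffunE => /t_inj; apply; exact: PP.
move=> _ /mapP[D DF ->]; rewrite mem_enum inE; have [inj_p rD cD] := hpD _ DF.
apply/andP; split.
  apply/injectiveP => i j; rewrite !ffunE => /t_inj h.
  by apply: inj_p; apply: h; exact: PP.
apply/asboolP; split.
  move=> i; exists (pD D i); split; first by apply: XP; exact: PP.
  rewrite ffunE; split; last by apply: ht; exact: PP.
  split=> //; case: ifPn => // /eqP ->; rewrite cD.
  by have [[_ ? ]] := hF _ DF.
have [_ /le_trans] := hF _ DF; apply; apply: le_counting => z [Yz zD].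
split=> // _ [i _ <-]; rewrite ffunE.
apply: (@ballF_grid_corner _ beta gamma gamma' n _ (pD D i)) => //.
- by apply: ht; exact: PP.
- by have /andP[_] := P01 _ (PP _ i DF).
- by apply: zD; exact: DD.
Qed.

End pointwise.

(** * Lower limits and a Markov inequality of real order *)

Lemma le_limn_einf (R : realType) (u : (\bar R)^nat) (c : \bar R) :
  (\forall n \near \oo, c <= u n)%E -> (c <= limn_einf u)%E.
Proof.
move=> [n _ h]; rewrite limn_einf_lim; apply: lime_ge; first exact: is_cvg_einfs.
exists n => // k /= nk; apply: le_ereal_inf_tmp => _ [j /= kj <-].
by apply: h; exact: leq_trans kj.
Qed.

Lemma limn_einf_le (R : realType) (u : (\bar R)^nat) (c : \bar R) :
  (forall n, u n <= c)%E -> (limn_einf u <= c)%E.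
Proof.
move=> h; rewrite limn_einf_lim; apply: lime_le; first exact: is_cvg_einfs.
apply: nearW => n; apply: le_trans (h n).
by apply: ereal_inf_lbound; exists n => /=.
Qed.

(** The rank from which [G n] dominates may depend on [F]. For finite [S] the set itself is taken as
    [F]; an infinite [S] has finite subsets of any size, which forces the lower limit to be
    infinite. *)
Lemma counting_le_limn_einf (R : realType) (T : choiceType) (S : set T)
    (G : (\bar R)^nat) :
  (forall F : seq T, uniq F -> (forall x, x \in F -> S x) ->
     \forall n \near \oo, ((size F)%:R%:E <= G n)%E) ->
  (counting S <= limn_einf G)%E.
Proof.
move=> h; have [fS|iS] := pselect (finite_set S).
  rewrite /counting asboolT//; apply/le_limn_einf; apply: h.
    exact: finmap.fset_uniq.
  by move=> x; rewrite in_fset_set// inE.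
rewrite /counting asboolF//.
rewrite leye_eq; apply/eqP/eqyP => r r0.
have [B BS] := infinite_set_fset (Num.truncn r).+1 iS.
move=> Br; apply: (@le_trans _ _ (size (finmap.enum_fset B))%:R%:E).
  rewrite lee_fin; apply: ltW; apply: (lt_le_trans (truncnS_gt r)).
  by rewrite ler_nat.
apply/le_limn_einf; apply: h; first exact: finmap.fset_uniq.
by move=> x xB; apply: BS.
Qed.

Section poisson_power_tail.
Context {R : realType} {d : measure_display} {Omega : measurableType d}.
Variables (Pr : probability Omega R) (mu : set (R * R) -> \bar R).
Variables (X : Omega -> set (R * R)).
Hypothesis pX : poisson_process Pr mu X.

(** Put x = j r / k. If x <= 1, the bound x^j of integer order is at most x^theta, since theta <= j;
    if x > 1, the right-hand side exceeds 1. *)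
Lemma prob_many_event_powR_le B r j k theta : measurable B -> mu B = r%:E -> 0 <= r ->
  (0 < j)%N -> (j <= k)%N -> 0 < theta <= j%:R ->
  (Pr (many_event X B k) <= ((j%:R * r / k%:R) `^ theta)%:E)%E.
Proof.
move=> mB mur r0 j0 jk /andP[t0 tj].
set x := j%:R * r / k%:R.
have x0 : 0 <= x by rewrite divr_ge0// mulr_ge0.
have [x1|x1] := leP x 1.
  apply: le_trans (prob_many_event_le pX mB mur r0 j0 jk) _.
  rewrite lee_fin -/x; move: x0; rewrite le_eqVlt => /predU1P[<-|x0].
    by rewrite expr0n gtn_eqF// powR_ge0.
  by rewrite -powR_mulrn ?(ltW x0)// ger_powR// x0.
apply: le_trans (probability_le1 _ _) _; first exact: (measurable_many_event pX).
rewrite lee_fin.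
have -> : 1 = 1 `^ theta :> R by rewrite powR1.
by rewrite ge0_ler_powR ?nnegrE// ltW.
Qed.

End poisson_power_tail.

(** * Disjointness and measure of the grid cells *)

Section cell_measure.
Context {R : realType}.
Variables (m : nat) (A : set R).
Hypothesis (mA : measurable A).

Definition grid_itv n (l : nat) : set R :=
  `[grid_loc n l, grid_loc n l + n.+1%:R^-1[%classic.

Lemma measurable_grid_itv n l : measurable (grid_itv n l).
Proof. exact: measurable_itv. Qed.

Lemma grid_itv_inj n l l' x : grid_itv n l x -> grid_itv n l' x -> l = l'.
Proof.
have h a b : grid_itv n a x -> grid_itv n b x -> (a <= b)%N.
  rewrite /grid_itv /= !in_itv/= /grid_loc => /andP[ha _] /andP[_ hb].
  rewrite -ltnS -(ltr_nat R).
  have : a%:R / n.+1%:R < b.+1%:R / n.+1%:R :> R.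
    rewrite -(ltrD2r (- n.+1%:R)) (le_lt_trans ha)// (lt_le_trans hb)//.
    by rewrite -[b.+1%:R]natr1 mulrDl mul1r addrAC.
  by rewrite ltr_pM2r// invr_gt0.
by move=> h1 h2; apply/eqP; rewrite eqn_leq !h.
Qed.

Lemma grid_cell_inj n (t t' : grid n) (q : R * R) :
  grid_cell t q -> grid_cell t' q -> t = t'.
Proof.
move=> [q1 q2] [q1' q2'].
have h1 : t.1 = t'.1 :> nat by exact: grid_itv_inj q1 q1'.
suff h2 : t.2 = t'.2 :> nat.
  by rewrite (surjective_pairing t) (surjective_pairing t'); congr pair; exact: val_inj.
have h a b : grid_mark n a <= q.2 -> q.2 < grid_mark n b + n.+1%:R^-1 -> (a <= b)%N.
  move=> ha hb; rewrite -2!ltnS -(ltr_nat R).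
  have : a.+1%:R / n.+1%:R < b.+2%:R / n.+1%:R :> R.
    by rewrite (le_lt_trans ha)// (lt_le_trans hb)// -[b.+2%:R]natr1 mulrDl mul1r.
  by rewrite ltr_pM2r// invr_gt0.
move: q2 q2'; rewrite /= !in_itv/= => /andP[a b] /andP[a' b'].
by apply/eqP; rewrite eqn_leq !h.
Qed.

Lemma trivIset_marked_cell n (v : {ffun 'I_m.+1 -> grid n}) : injective v ->
  trivIset setT (fun i => marked_cell A i (v i) : set (R * R)).
Proof.
move=> iv; apply/trivIsetP => i j _ _ ij; apply/seteqP; split=> // q [[_ h1] [_ h2]].
by move: ij; rewrite (iv _ _ (grid_cell_inj h1 h2)) eqxx.
Qed.

Definition cell_mass n (l : nat) : R := fine (lebesgue_measure (A `&` grid_itv n l)).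

Lemma cell_mass_ge0 n l : 0 <= cell_mass n l.
Proof. by rewrite fine_ge0. Qed.

Lemma lebesgue_grid_itv n l : lebesgue_measure (grid_itv n l) = (n.+1%:R^-1 : R)%:E.
Proof.
rewrite /grid_itv lebesgue_measure_itv/= lte_fin ltrDl invr_gt0 ltr0n/= -EFinB.
by rewrite addrAC subrr add0r.
Qed.

Lemma cell_massE n l :
  lebesgue_measure (A `&` grid_itv n l) = (cell_mass n l)%:E.
Proof.
rewrite /cell_mass fineK// ge0_fin_numE//.
apply: (@le_lt_trans _ _ (lebesgue_measure (grid_itv n l))).
  apply: le_measure; rewrite ?inE//; [|exact: measurable_grid_itv].
  by apply: measurableI => //; exact: measurable_grid_itv.
by rewrite lebesgue_grid_itv ltry.
Qed.

Lemma sum_cell_mass_le n k : (lebesgue_measure A <= 1)%E ->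
  \sum_(l < k) cell_mass n l <= 1.
Proof.
move=> A1; rewrite -lee_fin -sumEFin; apply: le_trans A1.
under eq_bigr do rewrite -cell_massE.
have mF l : measurable (A `&` grid_itv n l).
  by apply: measurableI => //; exact: measurable_grid_itv.
have tF : trivIset setT (fun l => A `&` grid_itv n l).
  apply/trivIsetP => i j _ _ ij; apply/seteqP; split=> // x [[_ h1] [_ h2]].
  by move: ij; rewrite (grid_itv_inj h1 h2) eqxx.
rewrite -(measure_bigsetU (@lebesgue_measure R) mF tF).
apply: le_measure; rewrite ?inE//.
  by apply: bigsetU_measurable => l _; exact: mF.
apply: (big_ind (fun S => S `<=` A)) => [x []|S T hS hT x [/hS|/hT]|l _ x []]//.
Qed.

Lemma measurable_marked_cell n (i : 'I_m.+1) (t : grid n) :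
  measurable (marked_cell A i t : set (R * R)).
Proof.
apply: measurableI.
  by apply: measurableX => //; case: ifPn.
by apply: measurableX; exact: measurable_itv.
Qed.

(** Not an equality in general: the cells of the top layer start at mark 1 and stick out of the
    strip. *)
Lemma strip_measure_marked_cell n (i : 'I_m.+1) (t : grid n) :
  (strip_measure (marked_cell A i t) <=
   ((if i == ord0 then cell_mass n t.1 else n.+1%:R^-1) * n.+1%:R^-1)%:E)%E.
Proof.
rewrite /marked_cell /grid_cell -/(grid_itv n t.1) -setXI setTI.
have mJ : measurable (`[grid_mark n t.2 : R, grid_mark n t.2 + n.+1%:R^-1[%classic : set R).
  exact: measurable_itv.
rewrite strip_measure_rect//; last first.
  by apply: measurableI; [case: ifPn|exact: measurable_grid_itv].
rewrite EFinM; apply: lee_pmul => //.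
  by case: ifPn => _; rewrite ?setTI ?cell_massE ?lebesgue_grid_itv.
apply: (@le_trans _ _ (lebesgue_measure
    `[grid_mark n t.2 : R, grid_mark n t.2 + n.+1%:R^-1[%classic)).
  apply: le_measure; rewrite ?inE//.
  by apply: measurableI => //; exact: measurable_itv.
rewrite lebesgue_measure_itv/= lte_fin ltrDl invr_gt0 ltr0n/= -EFinB.
by rewrite addrAC subrr add0r.
Qed.

End cell_measure.

(** * Upper bound *)

Section upper_bound.
Context {R : realType} {d : measure_display} {Omega : measurableType d}.
Variables (Pr : probability Omega R).
Variables (lambda lambda' beta gamma gamma' : R) (m : nat).
Variables (X Y : Omega -> set (R * R)) (A : set R).
Hypotheses (lambda_gt0 : 0 < lambda) (lambda'_gt0 : 0 < lambda') (beta_gt0 : 0 < beta).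
Hypotheses (gamma_gt0 : 0 < gamma) (gamma'_gt0 : 0 < gamma').
Hypothesis (gamma'_lt : gamma' * m.+1%:R < 1).
Hypothesis pX : poisson_process Pr (fun B => lambda%:E * strip_measure B)%E X.
Hypothesis pY : poisson_process Pr (fun B => lambda'%:E * strip_measure B)%E Y.
Hypothesis indepXY : independent_processes Pr X Y.
Hypotheses (mA : measurable A) (A1 : (lebesgue_measure A <= 1)%E).

Lemma process_bigcap (Z : Omega -> set (R * R)) n (F : 'I_n -> set Omega) :
  (forall i, process_sigma_algebra Z (F i)) ->
  process_sigma_algebra Z (\bigcap_(i in [set: 'I_n]) F i).
Proof.
move=> hF; rewrite /process_sigma_algebra; set G := (X in <<s X >>).
apply: (@fin_bigcap_measurable _ (g_sigma_algebraType G)) => //.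
by move=> i _; exact: hF.
Qed.

Let grid_event k n (v : {ffun 'I_m.+1 -> grid n}) : set Omega :=
  [set w | grid_config beta gamma gamma' A k (X w) (Y w) v].

Let grid_eventE k n (v : {ffun 'I_m.+1 -> grid n}) : grid_event k v =
  (\bigcap_(i in [set: 'I_m.+1]) many_event X (marked_cell A i (v i)) 1) `&`
  many_event Y (cover_ball beta gamma gamma' v) k.
Proof.
apply/seteqP; split=> w [h1 h2]; split=> //.
  by move=> i _; apply/counting_ge1; exact: h1.
by move=> i; have /counting_ge1 := h1 i I.
Qed.

Lemma measurable_cover_ball n (v : {ffun 'I_m.+1 -> grid n}) :
  measurable (cover_ball beta gamma gamma' v).
Proof. exact: measurable_ballF_set. Qed.

Let measurable_grid_event k n (v : {ffun 'I_m.+1 -> grid n}) :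
  measurable (grid_event k v).
Proof.
rewrite grid_eventE; apply: measurableI.
  apply: fin_bigcap_measurable => // i _; apply: (measurable_many_event pX).
  exact: measurable_marked_cell.
apply: (measurable_many_event pY); exact: measurable_cover_ball.
Qed.

Let cell_factor n (i : 'I_m.+1) (t : grid n) : R :=
  (if i == ord0 then cell_mass A n t.1 else n.+1%:R^-1) * n.+1%:R^-1.

(** The two processes separate by independence; injectivity of [v] makes the cells disjoint, so that
    [prob_hits_le] applies to X. *)
Let prob_grid_event_le k n (v : {ffun 'I_m.+1 -> grid n}) : injective v ->
  (Pr (grid_event k v) <= (\prod_i (lambda * cell_factor i (v i)))%:E *
     Pr (many_event Y (cover_ball beta gamma gamma' v) k))%E.
Proof.
move=> iv; rewrite grid_eventE indepXY; last 2 first.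
- apply: process_bigcap => // i; apply: process_many_event.
  exact: measurable_marked_cell.
- by apply: process_many_event; exact: measurable_cover_ball.
apply: lee_wpmul2r => //.
pose r i := lambda * fine (strip_measure (marked_cell A i (v i) : set (R * R))).
have smE i : strip_measure (marked_cell A i (v i) : set (R * R)) =
    (fine (strip_measure (marked_cell A i (v i) : set (R * R))))%:E.
  rewrite fineK// ge0_fin_numE; last exact: measure_ge0.
  by rewrite (le_lt_trans (strip_measure_marked_cell mA i (v i))) ?ltry.
have sm0 i : 0 <= fine (strip_measure (marked_cell A i (v i) : set (R * R))).
  by rewrite fine_ge0//; exact: measure_ge0.
apply: (@le_trans _ _ (\prod_i r i)%:E).
  apply: (prob_hits_le pX).
  - by rewrite /strip_measure set0I measure0 mule0.
  - by move=> i; exact: measurable_marked_cell.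
  - by move=> i; rewrite smE -EFinM.
  - by move=> i; rewrite /r mulr_ge0// ltW.
  - exact: trivIset_marked_cell.
rewrite lee_fin; apply: ler_prod => i _; rewrite /r mulr_ge0 ?(ltW lambda_gt0)//=.
rewrite ler_wpM2l ?(ltW lambda_gt0)// -lee_fin -smE.
exact: strip_measure_marked_cell.
Qed.

Let b1 : 0 < beta + 1. Proof. by rewrite addr_gt0. Qed.

Let gamma'_lt1 : gamma' < 1.
Proof.
by apply: le_lt_trans gamma'_lt; rewrite ler_peMr ?(ltW gamma'_gt0)// ler1n.
Qed.

Let C1 : R := 2 * (beta + 1) / (1 - 2^-1 `^ (1 - gamma')).

Let C1_ge0 : 0 <= C1.
Proof.
rewrite /C1 divr_ge0 ?mulr_ge0 ?(ltW b1)// subr_ge0.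
suff : 2^-1 `^ (1 - gamma') <= 1 `^ (1 - gamma') by rewrite powR1.
rewrite ge0_ler_powR ?nnegrE ?invr_ge0// ?subr_ge0 ?(ltW gamma'_lt1)//.
by rewrite invf_le1// ler1n.
Qed.

Let cover_mass n (v : {ffun 'I_m.+1 -> grid n}) : R :=
  fine (strip_measure (cover_ball beta gamma gamma' v)).

Let cover_mass_le_ereal n (v : {ffun 'I_m.+1 -> grid n}) i :
  (strip_measure (cover_ball beta gamma gamma' v) <=
   (C1 * grid_mark n (v i).2 `^ (- gamma))%:E)%E.
Proof.
apply: (@strip_measure_ballF_set_single_le _ _ _ _ b1 gamma'_gt0 m
  (fun i => grid_corner (v i)) i) => // j.
exact: grid_mark_gt0.
Qed.

Let cover_massE n (v : {ffun 'I_m.+1 -> grid n}) :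
  strip_measure (cover_ball beta gamma gamma' v) = (cover_mass v)%:E.
Proof.
rewrite /cover_mass fineK// ge0_fin_numE; last exact: measure_ge0.
by rewrite (le_lt_trans (cover_mass_le_ereal v ord0)) ?ltry.
Qed.

Let cover_mass_ge0 n (v : {ffun 'I_m.+1 -> grid n}) : 0 <= cover_mass v.
Proof. by rewrite fine_ge0//; exact: measure_ge0. Qed.

Section moment.
Variables (theta : R) (j : nat).
Hypotheses (theta_ge1 : 1 <= theta) (theta_le : theta <= j%:R).
(** The power theta - 1 of the volume is shared equally among the m + 1 vertices, each of which
    receives a factor u^(-kappa). The condition [kappa_lt] below amounts to theta < (m + 1) / gamma
    - m. *)
Let kappa : R := gamma * ((theta - 1) / m.+1%:R).
Hypothesis kappa_lt : gamma + kappa < 1.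

Let kappa_ge0 : 0 <= kappa.
Proof. by rewrite /kappa mulr_ge0 ?(ltW gamma_gt0)// divr_ge0// subr_ge0. Qed.

Let theta_gt0 : 0 < theta. Proof. exact: lt_le_trans theta_ge1. Qed.

Let j_gt0 : (0 < j)%N.
Proof. by rewrite -(ltr_nat R) (lt_le_trans theta_gt0). Qed.

(** One factor of the volume is kept, to be summed over the dyadic layers; the power theta - 1 is
    split into m + 1 equal powers, the i-th one being bounded through the ball of vertex i alone. *)
Let cover_mass_powR_le n (v : {ffun 'I_m.+1 -> grid n}) :
  cover_mass v `^ theta <=
  cover_mass v * (C1 `^ (theta - 1) * \prod_i grid_mark n (v i).2 `^ (- kappa)).
Proof.
rewrite -(mulr_powRB1 (cover_mass_ge0 v) theta_gt0) ler_wpM2l//.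
set e := (theta - 1) / m.+1%:R.
have e0 : 0 <= e by rewrite divr_ge0// subr_ge0.
have powE (x : R) : x `^ (theta - 1) = \prod_(i < m.+1) x `^ e.
  rewrite prodr_const card_ord -powR_mulrn ?powR_ge0// -powRrM.
  by rewrite /e divfK.
rewrite 2!powE -big_split/=; apply: ler_prod => i _; rewrite powR_ge0/=.
have -> : grid_mark n (v i).2 `^ (- kappa) = (grid_mark n (v i).2 `^ (- gamma)) `^ e.
  by rewrite -powRrM mulNr.
have h : cover_mass v <= C1 * grid_mark n (v i).2 `^ (- gamma).
  by rewrite -lee_fin -cover_massE.
have h0 : 0 <= C1 * grid_mark n (v i).2 `^ (- gamma) by rewrite mulr_ge0 ?powR_ge0.
rewrite -powRM ?powR_ge0//.
by apply: ge0_ler_powR => //; rewrite nnegrE.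
Qed.

Let alpha n l := cell_mass A n l.

Let factor k : R := lambda ^+ m.+1 * ((j%:R * lambda') `^ theta * C1 `^ (theta - 1))
  * k%:R `^ (- theta).

Let factor_ge0 k : 0 <= factor k.
Proof. by rewrite !mulr_ge0 ?powR_ge0// exprn_ge0// ltW. Qed.

Let prob_grid_event_weight_le k n (v : {ffun 'I_m.+1 -> grid n}) :
  injective v -> (j <= k)%N ->
  (Pr (grid_event k v) <= (factor k)%:E *
    ((\prod_i grid_weight (n := n) kappa (alpha n) i (v i))%:E *
     strip_measure (cover_ball beta gamma gamma' v)))%E.
Proof.
move=> iv jk; apply: le_trans (prob_grid_event_le k iv) _.
have k0 : (0 < k)%N by exact: leq_trans jk.
have P0 : 0 <= \prod_i (lambda * cell_factor i (v i)).
  apply: prodr_ge0 => i _; rewrite mulr_ge0 ?(ltW lambda_gt0)// mulr_ge0 ?invr_ge0//.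
  by case: ifPn; rewrite ?cell_mass_ge0 ?invr_ge0.
have muE : (lambda'%:E * strip_measure (cover_ball beta gamma gamma' v) =
    (lambda' * cover_mass v)%:E)%E by rewrite cover_massE.
have r0 : 0 <= lambda' * cover_mass v by rewrite mulr_ge0// ltW.
have t01 : 0 < theta <= j%:R by rewrite theta_gt0.
have h := prob_many_event_powR_le pY (measurable_cover_ball v) muE r0 j_gt0 jk t01.
apply: (le_trans (lee_wpmul2l _ h)); first by rewrite lee_fin.
rewrite cover_massE -!EFinM lee_fin.
have -> : j%:R * (lambda' * cover_mass v) / k%:R =
    (j%:R * lambda') * cover_mass v * k%:R^-1 by rewrite mulrA.
rewrite !powRM ?mulr_ge0 ?invr_ge0 ?(ltW lambda'_gt0)//.
have -> : k%:R^-1 `^ theta = k%:R `^ (- theta) :> R.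
  by rewrite -[k%:R^-1]powR_inv1// -powRrM mulN1r.
rewrite [X in X <= _](_ : _ = (\prod_i (lambda * cell_factor i (v i))) *
  ((j%:R * lambda') `^ theta * k%:R `^ (- theta)) * cover_mass v `^ theta); last first.
  by rewrite (@powRM _ j%:R lambda') ?(ltW lambda'_gt0)//; ring.
apply: (le_trans (ler_wpM2l _ (cover_mass_powR_le v))).
  by rewrite mulr_ge0// mulr_ge0 ?powR_ge0.
have -> : \prod_i grid_weight kappa (alpha n) i (v i) =
  (\prod_i cell_factor i (v i)) * \prod_i grid_mark n (v i).2 `^ (- kappa).
  by rewrite -big_split.
rewrite big_split/= prodr_const card_ord /factor.
by rewrite le_eqVlt; apply/predU1P; left; ring.
Qed.

Let sum_prob_grid_event_le k n : (j <= k)%N ->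
  (\sum_(v : {ffun 'I_m.+1 -> grid n})
     Pr (if injectiveb v then grid_event k v else set0) <=
   (factor k * grid_const (beta + 1) gamma gamma' m kappa)%:E)%E.
Proof.
move=> jk; rewrite EFinM.
have hs := @sum_grid_measure_le R (beta + 1) gamma gamma' b1 gamma_gt0 gamma'_gt0 n m
  kappa (alpha n) kappa_ge0 kappa_lt (cell_mass_ge0 A n) (sum_cell_mass_le mA n _ A1)
  gamma'_lt.
apply: le_trans (lee_wpmul2l _ hs); last by rewrite lee_fin.
have w0 (v : {ffun 'I_m.+1 -> grid n}) :
    (0 <= (\prod_i grid_weight kappa (alpha n) i (v i))%:E *
    strip_measure (cover_ball beta gamma gamma' v))%E.
  apply: mule_ge0; last exact: measure_ge0.
  by rewrite lee_fin; apply: prodr_ge0 => i _; apply: grid_weight_ge0; exact: cell_mass_ge0.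
rewrite ge0_sume_distrr//; apply: lee_sum => v _.
case: injectiveP => [iv|_]; first exact: prob_grid_event_weight_le.
by rewrite measure0 mule_ge0 ?lee_fin.
Qed.

(** Outside a null event the count is at most the lower limit of the number of injective cell tuples
    whose event occurs. The expectations of these numbers are bounded uniformly in the mesh, and
    Fatou's lemma passes to the limit. *)
Lemma integral_counting_simplices_deg_le : exists2 C : R, 0 <= C &
  forall k, (j <= k)%N ->
  (\int[Pr]_w counting (simplices_deg beta gamma gamma' m A k (X w) (Y w))
   <= (C * k%:R `^ (- theta))%:E)%E.
Proof.
pose C := lambda ^+ m.+1 * ((j%:R * lambda') `^ theta * C1 `^ (theta - 1)) *
  grid_const (beta + 1) gamma gamma' m kappa.
(* The absolute value makes the constant visibly nonnegative. *)
exists `|C| => // k jk.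
(* The null event that [X] has a point of mark 0, which no grid covers; the term
   [n%:R * \1_N0] in [G n] makes the bound trivial there. *)
pose N0 := many_event X ([set: R] `*` [set 0]) 1.
have mN0' : measurable ([set: R] `*` [set (0 : R)]) by exact: measurableX.
have mN0 : measurable N0 by apply: (measurable_many_event pX).
have PN0 : Pr N0 = 0%E.
  apply/eqP; rewrite eq_le measure_ge0 andbT.
  have e0 : (lambda%:E * strip_measure ([set: R] `*` [set 0%R]) = 0%R%:E)%E.
    rewrite strip_measure_rect// (_ : _ `&` _ = [set 0]).
      by rewrite lebesgue_measure_set1 !mule0.
    by apply/seteqP; split=> [x []//|x /= ->]; split=> //; rewrite /= in_itv/= lexx ler01.
  have := prob_many_event_le pX mN0' e0 (lexx 0) (ltnSn 0) (leqnn 1).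
  by rewrite mulr0 mul0r expr1.
pose E n (v : {ffun 'I_m.+1 -> grid n}) := if injectiveb v then grid_event k v else set0.
have mE n (v : {ffun 'I_m.+1 -> grid n}) : measurable (E n v).
  by rewrite /E; case: ifP.
pose G n w : \bar R := ((\sum_(v : {ffun 'I_m.+1 -> grid n}) (\1_(E n v) w)%:E) +
  (n%:R * \1_N0 w)%:E)%E.
have iE n (v : {ffun 'I_m.+1 -> grid n}) : measurable_fun setT (fun w => (\1_(E n v) w : R)%:E).
  by apply/measurable_EFinP; exact: measurable_indic.
have iN n : measurable_fun setT (fun w => (n%:R * \1_N0 w : R)%:E).
  by apply/measurable_EFinP; apply: measurable_funM.
have mG n : measurable_fun setT (G n).
  by apply: emeasurable_funD => //; exact: emeasurable_sum.
have G0 n w : (0 <= G n w)%E.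
  by rewrite adde_ge0 ?lee_fin// sume_ge0// => v _; rewrite lee_fin.
have intG n : (\int[Pr]_w G n w <= (`|C| * k%:R `^ (- theta))%:E)%E.
  have s0 w : [set: Omega] w ->
      (0 <= \sum_(v : {ffun 'I_m.+1 -> grid n}) (\1_(E n v) w : R)%:E)%E.
    by move=> _; apply: sume_ge0 => v _; rewrite lee_fin.
  have n0 w : [set: Omega] w -> (0 <= (n%:R * \1_N0 w : R)%:E)%E.
    by move=> _; rewrite lee_fin mulr_ge0.
  have ms : measurable_fun setT
      (fun w => (\sum_(v : {ffun 'I_m.+1 -> grid n}) (\1_(E n v) w : R)%:E)%E).
    exact: emeasurable_sum.
  rewrite /G (ge0_integralD Pr measurableT s0 ms n0 (iN n)).
  under [X in (_ + X <= _)%E]eq_integral do rewrite EFinM.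
  rewrite ge0_integralZl_EFin//=; last first.
    by apply/measurable_EFinP; exact: measurable_indic.
  rewrite integral_indic// setIT [X in (_ * X)%E]PN0 mule0 adde0.
  rewrite ge0_integral_sum//.
  under eq_bigr do rewrite integral_indic// setIT.
  apply: le_trans (sum_prob_grid_event_le n jk) _.
  rewrite lee_fin /factor mulrAC -/C ler_wpM2r ?powR_ge0//.
  by rewrite (le_trans _ (ler_norm C))// /C mulrAC.
apply: le_trans (limn_einf_le intG).
apply: le_trans (fatou Pr measurableT mG (fun n w _ => G0 n w)).
apply: ge0_le_lower_integral => w; first exact: counting_ge0.
apply: counting_le_limn_einf => F uF hF.
have [wN|wN] := pselect (N0 w).
  exists (size F) => // n /= nF; apply: (@le_trans _ _ (n%:R * \1_N0 w)%:E).
    by rewrite indicE mem_set// mulr1 lee_fin ler_nat.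
  by rewrite leeDr// sume_ge0// => v _; rewrite lee_fin.
have X0 : X w `&` ([set: R] `*` [set 0]) = set0.
  by apply/eqP/negP => /negP/set0P h; apply: wN; apply/counting_ge1.
apply: filterS (near_card_simplices_deg_le gamma_gt0 gamma'_gt0
  (pp_strip pX (w := w)) X0 uF hF) => n hn.
apply: (@le_trans _ _ (\sum_(v : {ffun 'I_m.+1 -> grid n}) (\1_(E n v) w)%:E)%E).
  rewrite sumEFin lee_fin; move: hn; rewrite -(ler_nat R) => /le_trans; apply.
  rewrite -sum1_card natr_sum big_mkcond/=; apply: ler_sum => v _.
  rewrite inE; case: ifPn => // /andP[iv /asboolP h].
  by rewrite indicE mem_set// /E iv.
by rewrite leeDl// lee_fin mulr_ge0.
Qed.

End moment.
End upper_bound.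

(** * Lower bound *)

Lemma ballF_box (R : realType) (beta gamma gamma' h l : R) (p z : R * R) :
  0 < gamma -> 0 < gamma' -> 0 <= p.2 <= h -> `|p.1 - z.1| <= l ->
  l * h `^ gamma <= beta -> strip z -> ballF beta gamma gamma' p z.
Proof.
move=> g0 g'0 /andP[p0 ph] pz lh sz; split=> //; rewrite /kernelF.
have [_ /=] := sz; rewrite in_itv/= => /andP[z0 z1].
have h0 : 0 <= h by exact: le_trans ph.
apply: le_trans lh; rewrite -[leRHS]mulr1.
rewrite ler_pM ?mulr_ge0 ?powR_ge0//.
  by rewrite ler_pM ?powR_ge0// ge0_ler_powR ?nnegrE ?(ltW g0).
suff : z.2 `^ gamma' <= 1 `^ gamma' by rewrite powR1.
by rewrite ge0_ler_powR ?nnegrE ?(ltW g'0).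
Qed.

Lemma card_range_ord (T : pointedType) n (p : 'I_n.+1 -> T) : injective p ->
  (range p #= `I_n.+1)%card.
Proof.
move=> ip; rewrite card_eq_sym; apply/card_set_bijP; exists (p \o inord).
split=> [i /= _|i j|_ [i _ <-]].
- by exists (inord i).
- rewrite !inE /= => im jm /ip /(congr1 val); rewrite /= !inordK//.
- by exists (val i) => /=; [exact: ltn_ord|rewrite inord_val].
Qed.

(** The set [A] may be unbounded, whereas the lower bound needs a center near the other vertices. By
    countable subadditivity, some bounded part of [A] has positive measure. *)
Lemma exists_bounded_part_gt0 (R : realType) (A : set R) : measurable A ->
  lebesgue_measure A = 1%E -> exists2 a : R, 0 <= a &
  (0 < lebesgue_measure (A `&` `[(- a)%R : R, a[%classic) <= 1)%E.
Proof.
move=> mA A1.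
have mAn (n : nat) : measurable (A `&` `[- n%:R, n%:R[%classic).
  by apply: measurableI => //; exact: measurable_itv.
have le1 (n : nat) : (lebesgue_measure (A `&` `[(- n%:R)%R : R, n%:R[%classic) <= 1)%E.
  rewrite -A1; apply: le_measure; [by rewrite inE; exact: mAn|by rewrite inE|].
  exact: subIsetl.
have [n hn] : exists n : nat, (0 < lebesgue_measure (A `&` `[(- n%:R)%R : R, n%:R[%classic))%E.
  apply: contrapT => /forallNP h.
  have : (lebesgue_measure A <=
      \sum_(0 <= n <oo) lebesgue_measure (A `&` `[(- n%:R)%R : R, n%:R[%classic))%E.
    apply: measure_sigma_subadditive => // x Ax.
    exists (Num.truncn `|x|).+1 => //; split => //=; rewrite in_itv/=.
    have := truncnS_gt `|x|; rewrite ltr_norml => /andP[a ->].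
    by rewrite andbT ltW.
  rewrite eseries0 ?A1 ?lee_fin ?ler10// => n _ _.
  by apply/eqP; rewrite eq_le measure_ge0 andbT leNgt; exact/negP.
by exists n%:R => //; rewrite hn le1.
Qed.

Section lower_bound.
Context {R : realType} {d : measure_display} {Omega : measurableType d}.
Variables (Pr : probability Omega R).
Variables (lambda lambda' beta gamma gamma' : R) (m : nat).
Variables (X Y : Omega -> set (R * R)) (A : set R).
Hypotheses (lambda_gt0 : 0 < lambda) (lambda'_gt0 : 0 < lambda').
Hypotheses (gamma_gt0 : 0 < gamma) (gamma'_gt0 : 0 < gamma').
Hypothesis pX : poisson_process Pr (fun B => lambda%:E * strip_measure B)%E X.
Hypothesis pY : poisson_process Pr (fun B => lambda'%:E * strip_measure B)%E Y.
Hypothesis indepXY : independent_processes Pr X Y.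
Hypothesis mA : measurable A.

Section boxes.
Variables (a alpha : R) (k : nat) (delta : R).
Hypotheses (a_ge0 : 0 <= a).
Hypothesis (alpha_gt0 : 0 < alpha).
Hypothesis (alphaE : lebesgue_measure (A `&` `[- a, a[%classic) = alpha%:E).
Hypotheses (k_gt0 : (0 < k)%N) (delta_gt0 : 0 < delta) (delta_le : 2 * delta <= 1).
(** Chosen so that [k%:R * K] bounds the distance in location from a point of any box to a point of
    the window. *)
Let K : R := 2 * a + m%:R + 2 / lambda'.
Hypothesis delta_ball : k%:R * K * (2 * delta) `^ gamma <= beta.

Let location_box (i : nat) : set R :=
  if i is j.+1 then `[a + j%:R * k%:R, a + j.+1%:R * k%:R[%classic
  else A `&` `[- a, a[%classic.

(** Box 0 lies strictly below the others up to its closed upper end, which they exclude; its point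
    is thus the unique vertex of lowest mark, that is, the center. *)
Let mark_box (i : nat) : set R :=
  if i is j.+1 then `]delta, 2 * delta]%classic else `[0, delta]%classic.

Let box i : set (R * R) := location_box i `*` mark_box i.

(** The width 2k / lambda' gives 2k expected Y-points, hence at least k of them with probability at
    least 1/2. *)
Let window : set (R * R) := `[a, a + 2 * k%:R / lambda'[ `*` `[0, 1].

Let intensity (i : nat) : R := lambda * ((if i is 0 then alpha else k%:R) * delta).

Let measurable_location_box i : measurable (location_box i).
Proof.
by case: i => [|i]; [apply: measurableI => //; exact: measurable_itv|exact: measurable_itv].
Qed.

Let measurable_mark_box i : measurable (mark_box i).
Proof. by case: i => [|i]; exact: measurable_itv. Qed.

Let measurable_box i : measurable (box i).
Proof. exact: measurableX. Qed.

Let box_measure i :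
  (lambda%:E * strip_measure (box i) = (intensity i)%:E)%E.
Proof.
rewrite strip_measure_rect// /intensity EFinM EFinM; congr (_ * (_ * _))%E.
  case: i => [|i] /=; first exact: alphaE.
  rewrite lebesgue_measure_itv/= lte_fin ltrD2l ltr_pM2r ?ltr0n// ltr_nat ltnSn.
  by rewrite -EFinB -[i.+1%:R]natr1; congr (_%:E); ring.
have -> : mark_box i `&` `[0, 1]%classic = mark_box i.
  apply/setIidPl; case: i => [|i] u /=; rewrite !in_itv/= => /andP[u0 ud].
    rewrite u0/=; move: delta_gt0 delta_le; lra.
  apply/andP; move: delta_gt0 delta_le; split; lra.
case: i => [|i] /=; rewrite lebesgue_measure_itv/= lte_fin.
  by rewrite delta_gt0 -EFinB subr0.
rewrite (_ : delta < 2 * delta); last by rewrite mulr_natl mulr2n ltrDr.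
by rewrite -EFinB; congr (_%:E); ring.
Qed.

Let window_measure :
  (lambda'%:E * strip_measure window = (2 * k)%:R%:E)%E.
Proof.
rewrite strip_measure_rect// setIid.
rewrite lebesgue_measure_itv/= lte_fin.
have w0 : 0 < 2 * k%:R / lambda' by rewrite divr_gt0// mulr_gt0// ltr0n.
rewrite ltrDl w0 lebesgue_measure_itv/= lte_fin ltr01 -!EFinB -!EFinM.
congr (_%:E); rewrite natrM; field; exact: lt0r_neq0.
Qed.

Let box_location_le i (p : R * R) : (i <= m)%N -> box i p ->
  - a <= p.1 <= a + m%:R * k%:R.
Proof.
move=> im [h _]; case: i im h => [|i] im /=.
  rewrite in_itv/= => -[_ /andP[-> h]] /=; rewrite (le_trans (ltW h))// lerDl.
  by rewrite mulr_ge0.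
rewrite in_itv/= => /andP[h1 h2]; apply/andP; split.
  apply: le_trans h1; rewrite (@le_trans _ _ a)//; first by move: a_ge0; lra.
  by rewrite lerDl mulr_ge0.
by rewrite (le_trans (ltW h2))// lerD2l ler_wpM2r// ler_nat.
Qed.

Let box_mark_le i (p : R * R) : box i p -> 0 <= p.2 <= 2 * delta.
Proof.
move=> [_]; case: i => [|i] /=; rewrite in_itv/= => /andP[h1 h2].
  by apply/andP; split; move: delta_gt0; lra.
by apply/andP; split; move: delta_gt0; lra.
Qed.

Let box_window_ball i (p z : R * R) : (i <= m)%N -> box i p -> window z ->
  ballF beta gamma gamma' p z.
Proof.
move=> im bp wz.
apply: (@ballF_box _ _ _ _ (2 * delta) (k%:R * K)) => //; first exact: box_mark_le bp.
  have /andP[p1 p2] := box_location_le im bp.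
  have [/= + _] := wz; rewrite in_itv/= => /andP[z1 z2].
  have k1 : 1 <= k%:R :> R by rewrite ler1n.
  have ak : a <= a * k%:R by rewrite ler_peMr.
  have lk : 0 <= 2 * k%:R / lambda' by rewrite divr_ge0 ?mulr_ge0// ltW.
  have mk : 0 <= m%:R * k%:R :> R by rewrite mulr_ge0.
  have -> : k%:R * K = 2 * (a * k%:R) + m%:R * k%:R + 2 * k%:R / lambda'.
    by rewrite /K; ring.
  move: a_ge0 ak lk mk p2 z2.
  move: (a * k%:R) (m%:R * k%:R : R) (2 * k%:R / lambda') => x y t a0 ak lk mk p2 z2.
  by rewrite ler_norml; apply/andP; split; lra.
by case: wz.
Qed.

Let trivIset_box : trivIset setT (fun i : 'I_m.+1 => box i).
Proof.
have h (i j : nat) p : (i < j)%N -> box i p -> box j p -> False.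
  case: j => // j; case: i => [|i] ij [hi ui] [hj uj].
    move: ui uj; rewrite /= !in_itv/= => /andP[_ u1] /andP[u2 _].
    by have := lt_le_trans u2 u1; rewrite ltxx.
  move: hi hj; rewrite /= !in_itv/= => /andP[_ u1] /andP[u2 _].
  have := le_lt_trans u2 u1; rewrite ltrD2l ltr_pM2r ?ltr0n// ltr_nat.
  by rewrite ltnS leqNgt -ltnS ij.
apply/trivIsetP => i j _ _ ij; apply/seteqP; split=> // p [bi bj].
have : (val i != val j) by [].
by rewrite neq_ltn => /orP[] lt; [exact: h lt bi bj|exact: h lt bj bi].
Qed.

(** Exactly one point per box is required, rather than at least one, so that the product formula for
    counts applies directly. *)
Let box_event : set Omega :=
  (\bigcap_(i in [set: 'I_m.+1]) count_event X (box i) 1) `&` many_event Y window k.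

Let measurable_window : measurable window.
Proof. by apply: measurableX; exact: measurable_itv. Qed.

Let measurable_box_event : measurable box_event.
Proof.
apply: measurableI; last exact: (measurable_many_event pY).
by apply: fin_bigcap_measurable => // i _; exact: (pp_measurable pX).
Qed.

Let prob_box_event_ge :
  ((1 / 2 * \prod_(i < m.+1) (expR (- intensity i) * intensity i))%:E <=
   Pr box_event)%E.
Proof.
have i0 i : 0 <= intensity i.
  rewrite /intensity !mulr_ge0 ?(ltW lambda_gt0) ?(ltW delta_gt0)//.
  by case: i => [|i]; rewrite ?(ltW alpha_gt0).
rewrite /box_event indepXY; last 2 first.
- apply: process_bigcap => i; apply: sub_sigma_algebra.
  by exists (box i), 1%N.
- exact: process_many_event.
rewrite (pp_indep pX (fun=> 1%N))//; last by move=> i; rewrite box_measure ltry.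
rewrite (eq_bigr (fun i : 'I_m.+1 => (expR (- intensity i) * intensity i)%:E)).
  rewrite prodEFin mulrC EFinM.
  apply: lee_wpmul2l.
    by rewrite lee_fin prodr_ge0// => i _; rewrite mulr_ge0 ?expR_ge0.
  exact: (prob_many_event_ge pY measurable_window window_measure).
move=> i _; rewrite (prob_count_event pX 1 (measurable_box i) (box_measure i) (i0 i)).
by rewrite expr1 factS fact0 muln1 divr1.
Qed.

Let box_event_simplex w : box_event w ->
  simplices_deg beta gamma gamma' m A k (X w) (Y w) !=set0.
Proof.
move=> [hX hY].
have /choice[p hp] : forall i : 'I_m.+1, exists p, X w p /\ box i p.
  move=> i; have : (1 <= counting (X w `&` box i) :> \bar R)%E.
    by rewrite (hX i I).
  by move=> /counting_ge1[p pp]; exists p.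
have p_inj : injective p.
  move=> i j pij; apply/eqP/negP => /negP ij.
  have /trivIsetP/(_ i j I I ij) := trivIset_box.
  move/seteqP => [/(_ (p i)) + _]; apply; split; first by have [] := hp i.
  by rewrite pij; have [] := hp j.
have sub : Y w `&` window `<=` Y w `&` ballF_set beta gamma gamma' (range p).
  move=> z [Yz wz]; split=> // _ [i _ <-].
  by apply: (box_window_ball (i := i)) => //; [rewrite -ltnS; exact: ltn_ord|have [] := hp i].
exists (range p); split; last first.
  by apply: le_trans hY _; exact: le_counting.
split.
  split.
  - by move=> _ [i _ <-]; have [] := hp i.
  - exact: card_range_ord.
  - apply/(@counting_ge1 _ R); apply: le_trans (le_counting sub).
    by apply: le_trans hY; rewrite lee_fin ler1n.
have [Xp0 [[/= Ap0 _] m0]] := hp ord0.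
rewrite (@center_vertexE _ _ (p ord0))//; split; first by exists ord0.
move=> _ [i _ <-]; have [->|i0] := eqVneq i ord0; first by right.
left; have [_ [_ mi]] := hp i; move: m0 mi i0.
case: i {hX} => -[|i] //= im; rewrite !in_itv/= => /andP[_ h1] /andP[h2 _] _.
exact: le_lt_trans h1 h2.
Qed.

Lemma integral_counting_simplices_deg_ge :
  ((1 / 2 * \prod_(i < m.+1) (expR (- intensity i) * intensity i))%:E <=
   \int[Pr]_w counting (simplices_deg beta gamma gamma' m A k (X w) (Y w)))%E.
Proof.
apply: le_trans prob_box_event_ge _.
have -> : Pr box_event = (\int[Pr]_w (\1_box_event w)%:E)%E.
  by rewrite integral_indic// setIT.
apply: ge0_le_lower_integral => w; first by rewrite lee_fin.
rewrite indicE; case: (boolP (w \in _)) => [/set_mem h|_]; last exact: counting_ge0.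
exact/counting_ge1/box_event_simplex.
Qed.

End boxes.
End lower_bound.

(** * Logarithmic asymptotics *)

(** On the logarithmic scale the constants, [L] included, vanish after division by ln k. Upper
    bounds for all exponents below [s] suffice, since [theta] can be taken as close to [s] as
    desired. *)
Lemma cvg_log_ratio (R : realType) (u : (\bar R)^nat) (L s : R) :
  0 < L -> 1 < s ->
  (exists2 c, 0 < c & \forall k \near \oo, ((c * k%:R `^ (- s))%:E <= u k)%E) ->
  (forall theta, 1 <= theta < s -> exists2 C, 0 <= C &
     \forall k \near \oo, (u k <= (C * k%:R `^ (- theta))%:E)%E) ->
  (fun k => lne (u k / L%:E) / (ln (k%:R : R))%:E)%E @ \oo --> (- s)%:E.
Proof.
move=> L0 s1 [c c0 lower] upper.
(* Exponent 1 serves to show that [u k] is eventually finite. *)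
have [C1 C10 upper1] : exists2 C, 0 <= C &
    \forall k \near \oo, (u k <= (C * k%:R `^ (- 1))%:E)%E.
  by apply: upper; rewrite lexx.
have lnlarge (B : R) : \forall k \near \oo, B <= ln (k%:R : R).
  near=> k; rewrite -[B]expRK ler_ln ?posrE ?expR_gt0//.
    by near: k; exact: nbhs_infty_ger.
  by rewrite ltr0n; near: k; exact: nbhs_infty_gt.
have kpos : \forall k \near \oo, 0 < (k%:R : R).
  by near=> k; rewrite ltr0n; near: k; exact: nbhs_infty_gt.
have ufin : \forall k \near \oo, u k = (fine (u k))%:E /\ 0 < fine (u k).
  apply: filterS3 lower upper1 kpos => k lk uk k0.
  have e : u k = (fine (u k))%:E.
    rewrite fineK// ge0_fin_numE; first exact: le_lt_trans uk (ltry _).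
    by apply: le_trans lk; rewrite lee_fin mulr_ge0 ?powR_ge0// ltW.
  split=> //; move: lk; rewrite e lee_fin; apply: lt_le_trans.
  by rewrite mulr_gt0// powR_gt0.
have eqk : \forall k \near \oo,
    (lne (u k / L%:E) / (ln (k%:R : R))%:E)%E = (ln (fine (u k) / L) / ln k%:R)%:E.
  apply: filterS2 ufin (lnlarge 1) => k [e u0] lk.
  rewrite e inver gt_eqF// -EFinM lne_EFin ?divr_gt0// inver gt_eqF//.
  exact: lt_le_trans lk.
have split_ln (q theta : R) (k : nat) : 0 < q -> 0 < (k%:R : R) ->
    ln (q * k%:R `^ (- theta) / L) = ln (q / L) - theta * ln k%:R.
  move=> q0 k0; rewrite mulrAC [LHS]lnM ?posrE ?divr_gt0 ?powR_gt0//.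
  by rewrite ln_powR mulNr.
apply/fine_cvgP; split; first by apply: filterS eqk => k ->.
apply/cvgrPdist_le => e e0.
(* Half of the error [e] goes to the exponent, the other half absorbs the constant once ln k is
   large. *)
pose theta := Num.max 1 (s - e / 2).
have theta_s : 1 <= theta < s.
  by rewrite le_max lexx/= gt_max s1/= ltrBlDr ltrDl divr_gt0.
have theta_e : s - e / 2 <= theta by rewrite le_max lexx orbT.
have [C C0 uppert] := upper _ theta_s.
near=> k.
have k0 : 0 < (k%:R : R) by near: k; exact: kpos.
have lk : 1 <= ln (k%:R : R) by near: k; exact: lnlarge.
have lk0 : 0 < ln (k%:R : R) by exact: lt_le_trans lk.
have [ue u0] : u k = (fine (u k))%:E /\ 0 < fine (u k) by near: k; exact: ufin.
have -> : (fine \o (fun k => lne (u k / L%:E) / (ln (k%:R : R))%:E)%E) k =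
    ln (fine (u k) / L) / ln k%:R.
  rewrite /= (_ : (_ / _)%E = (ln (fine (u k) / L) / ln k%:R)%:E)//.
  by near: k; exact: eqk.
rewrite ler_distlC; apply/andP; split.
  rewrite ler_pdivlMr//.
  have : ln (c * k%:R `^ (- s) / L) <= ln (fine (u k) / L).
    rewrite ler_ln ?posrE ?divr_gt0 ?mulr_gt0 ?powR_gt0// ler_pM2r ?invr_gt0//.
    by rewrite -lee_fin -ue; near: k; exact: lower.
  rewrite split_ln//; apply: le_trans.
  have : - ln (c / L) / e <= ln (k%:R : R) by near: k; exact: lnlarge.
  by rewrite ler_pdivrMr//; move: (ln (c / L)) (ln (k%:R : R)) => t l; nra.
rewrite ler_pdivrMr//.
(* [C] may be 0; the maximum with 1 makes its logarithm usable. *)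
have C0' : 0 < Num.max C 1 by rewrite lt_max ltr01 orbT.
have : ln (fine (u k) / L) <= ln (Num.max C 1 * k%:R `^ (- theta) / L).
  rewrite ler_ln ?posrE ?divr_gt0 ?mulr_gt0 ?powR_gt0// ler_pM2r ?invr_gt0//.
  rewrite -lee_fin -ue; apply: (@le_trans _ _ (C * k%:R `^ (- theta))%:E).
    by near: k; exact: uppert.
  by rewrite lee_fin ler_wpM2r ?powR_ge0// le_max lexx.
rewrite split_ln// => /le_trans; apply.
have : ln (Num.max C 1 / L) / (e / 2) <= ln (k%:R : R) by near: k; exact: lnlarge.
rewrite ler_pdivrMr ?divr_gt0//; move: (ln (_ / L)) => t.
by move: (ln (k%:R : R)) lk0 theta_e => l; nra.
Unshelve. all: by end_near. Qed.

(** * From the typical degree to expected numbers of simplices *)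

Section counting_esum.
Import finmap.

Lemma counting_esum (R : realType) (T : choiceType) (S : set T) :
  counting S = (\esum_(i in S) 1)%E :> \bar R.
Proof.
have sum1 (B : {fset T}) :
    (\sum_(i \in [set` B]) (1 : \bar R))%E = (size (finmap.enum_fset B))%:R%:E :> \bar R.
  rewrite fsbig_finite//= set_fsetK big_const_seq count_predT.
  by elim: (size _) => //= q ->; rewrite -EFinD -natr1 addrC.
have [fS|iS] := pselect (finite_set S).
  rewrite esum_fset// /counting asboolT//.
  by rewrite -{2}(fset_setK fS) sum1.
rewrite /counting asboolF//; apply/esym/eqyP => r r0.
have [B BS hB] := infinite_set_fset (Num.truncn r).+1 iS.
apply: esum_ge; exists [set` B]; first by split.
rewrite sum1 lee_fin; apply: ltW; apply: (lt_le_trans (truncnS_gt r)).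
by rewrite ler_nat.
Qed.

End counting_esum.

Section shifts.
Context {R : realType}.
Variables (beta gamma gamma' : R).
Implicit Types (Y D : set (R * R)).

Let tr (x : R) (p : R * R) : R * R := (p.1 - x, p.2).

Let tr_inj x : injective (tr x).
Proof. by move=> [a b] [a' b'] [/addIr-> ->]. Qed.

Let ballF_tr x p q : ballF beta gamma gamma' (tr x p) (tr x q) <-> ballF beta gamma gamma' p q.
Proof.
rewrite /ballF /kernelF /tr /strip /=.
by rewrite (_ : p.1 - x - (q.1 - x) = p.1 - q.1)//; ring.
Qed.

(** The kernel depends on locations only through their difference, so a translation maps the
    Y-points of the common ball bijectively to those of the translated one. *)
Lemma degree_shift x Y D :
  degree beta gamma gamma' (Defs.shift x Y) (Defs.shift x D) =
  degree beta gamma gamma' Y D.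
Proof.
rewrite /degree !counting_esum.
have -> : Defs.shift x Y `&` ballF_set beta gamma gamma' (Defs.shift x D) =
    tr x @` (Y `&` ballF_set beta gamma gamma' D).
  apply/seteqP; split=> [_ [[q Yq <-] h]|_ [q [Yq h] <-]].
    exists q => //; split=> // p Dp; apply/(ballF_tr x); apply: h.
    by exists p.
  by split; [exists q|move=> _ [p Dp <-]; apply/(ballF_tr x); exact: h].
by rewrite esum_image// => p q _ _; exact: tr_inj.
Qed.

Variables (m : nat) (A : set R).

(** The common ball of a simplex contains a Y-point by definition. The intensity is therefore the
    case [k = 1] of the expected counts. *)
Lemma simplices_deg1 X Y :
  simplices_deg beta gamma gamma' m A 1 X Y = simplices_in beta gamma gamma' m A X Y.
Proof.
apply/seteqP; split=> [D []//|D h]; split=> //.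
by apply/counting_ge1; have [[]] := h.
Qed.

Lemma le_simplices_deg k l X Y : (k <= l)%N ->
  simplices_deg beta gamma gamma' m A l X Y `<=` simplices_deg beta gamma gamma' m A k X Y.
Proof.
move=> kl D [h1 h2]; split=> //; apply: le_trans h2.
by rewrite lee_fin ler_nat.
Qed.

Lemma typical_degree_tailE d (Omega : measurableType d) (Pr : probability Omega R)
    (X Y : Omega -> set (R * R)) k :
  typical_degree_tail Pr beta gamma gamma' X Y m A k =
  ((\int[Pr]_w counting (simplices_deg beta gamma gamma' m A k (X w) (Y w))) /
   (\int[Pr]_w counting (simplices_deg beta gamma gamma' m A 1 (X w) (Y w))))%E.
Proof.
rewrite /typical_degree_tail /typical_simplex_expectation /simplex_intensity.
congr (_ / _)%E; apply: eq_integral => w _; last by rewrite simplices_deg1.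
rewrite counting_esum.
rewrite (_ : simplices_deg _ _ _ _ _ _ _ _ = simplices_in beta gamma gamma' m A (X w) (Y w) `&`
  [set D | (k%:R%:E <= degree beta gamma gamma' (Y w) D :> \bar R)%E])//.
rewrite [RHS]esum_mkcondr; apply: eq_esum => D _.
by rewrite degree_shift mem_setE.
Qed.

End shifts.

(** The boxes have height delta of order k^(-1/gamma), and m of them have width k. Their intensities
    are bounded, so the probability of one point in each is of order k^m delta^(m+1). *)
Lemma integral_counting_simplices_deg_ge_powR (R : realType) d (Omega : measurableType d)
    (Pr : probability Omega R) (lambda lambda' beta gamma gamma' : R) (m : nat)
    (X Y : Omega -> set (R * R)) (A : set R) :
  0 < lambda -> 0 < lambda' -> 0 < beta -> 0 < gamma < 1 -> 0 < gamma' ->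
  poisson_process Pr (fun B => lambda%:E * strip_measure B)%E X ->
  poisson_process Pr (fun B => lambda'%:E * strip_measure B)%E Y ->
  independent_processes Pr X Y ->
  measurable A -> lebesgue_measure A = 1%E ->
  exists2 c : R, 0 < c & \forall k \near \oo,
    ((c * k%:R `^ (m%:R - m.+1%:R / gamma))%:E <=
     \int[Pr]_w counting (simplices_deg beta gamma gamma' m A k (X w) (Y w)))%E.
Proof.
move=> l0 l'0 b0 /andP[g0 g1] g'0 pX pY iXY mA A1.
have [a a0 /andP[al0 al1]] := exists_bounded_part_gt0 mA A1.
have alfin : lebesgue_measure (A `&` `[- a, a[%classic) \is a fin_num.
  by rewrite ge0_fin_numE// (le_lt_trans al1)// ltry.
have alE := esym (fineK alfin).
move: al0 al1 alE; set alpha := fine _ => al0 al1 alE.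
rewrite alE lte_fin in al0; rewrite alE lee_fin in al1.
pose K := 2 * a + m%:R + 2 / lambda'.
have K0 : 0 < K by rewrite ltr_wpDl ?divr_gt0// addr_ge0// mulr_ge0.
(* Chosen so that 2 delta = (beta / (K k))^(1/gamma), for which the condition on the balls holds
   with equality. *)
pose d0 := 2^-1 * (beta / K) `^ gamma^-1.
have d00 : 0 < d0 by rewrite mulr_gt0 ?powR_gt0 ?divr_gt0// invr_gt0.
(* An upper bound, uniform in [k], on the intensities of all boxes: 2 delta <= beta / (K k), because
   gamma < 1 and beta / (K k) <= 1. The exponential factors are then at least exp(-M). *)
pose M := lambda * (beta / (2 * K)).
pose c := 1 / 2 * (expR (- M) ^+ m.+1 * lambda ^+ m.+1 * alpha * d0 ^+ m.+1).
have c0 : 0 < c by rewrite /c !mulr_gt0 ?exprn_gt0 ?expR_gt0// divr_gt0.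
exists c => //; near=> k.
have kK : beta / K <= k%:R by near: k; exact: nbhs_infty_ger.
have k0 : (0 < k)%N by near: k; exact: nbhs_infty_gt.
have k0' : 0 < (k%:R : R) by rewrite ltr0n.
have k1 : 1 <= (k%:R : R) by rewrite ler1n.
pose delta := d0 * k%:R `^ (- gamma^-1).
have delta0 : 0 < delta by rewrite mulr_gt0// powR_gt0.
pose x := beta / (K * k%:R).
have x0 : 0 < x by rewrite divr_gt0// mulr_gt0.
have x1 : x <= 1 by rewrite ler_pdivrMr ?mulr_gt0// mul1r mulrC -ler_pdivrMr.
have deltaE : 2 * delta = x `^ gamma^-1.
  have -> : x = beta / K * k%:R^-1 by rewrite /x invfM mulrA.
  have bK0 : 0 <= beta / K by rewrite divr_ge0 ?(ltW b0) ?(ltW K0).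
  have kV0 : 0 <= k%:R^-1 :> R by rewrite invr_ge0 ltW.
  rewrite (powRM _ bK0 kV0) /delta /d0.
  have -> : k%:R^-1 `^ gamma^-1 = k%:R `^ (- gamma^-1) :> R.
    by rewrite -(powR_inv1 (ltW k0')) -powRrM mulN1r.
  by rewrite !mulrA mulfV// mul1r.
have delta_x : 2 * delta <= x.
  rewrite deltaE ge1r_powR ?x0// invf_ge1// ltW//.
have delta1 : 2 * delta <= 1 by exact: le_trans x1.
have kdelta : k%:R * delta <= beta / (2 * K).
  have : k%:R * (2 * delta) <= k%:R * x by rewrite ler_wpM2l// ltW.
  rewrite (_ : k%:R * x = 2 * (beta / (2 * K))); last first.
    by rewrite /x; field; rewrite !lt0r_neq0.
  by rewrite mulrCA ler_pM2l.
have ball : k%:R * K * (2 * delta) `^ gamma <= beta.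
  rewrite deltaE -powRrM mulVf ?lt0r_neq0// powRr1 ?(ltW x0)//.
  by rewrite /x mulrC [k%:R * K]mulrC divfK// lt0r_neq0// mulr_gt0.
apply: le_trans (integral_counting_simplices_deg_ge l0 l'0 g0 g'0 pX pY iXY mA
  a0 al0 alE k0 delta0 delta1 ball).
rewrite lee_fin /c -[leLHS]mulrA ler_wpM2l//.
pose r (i : nat) : R := lambda * ((if i is 0 then alpha else k%:R) * delta).
have r0 i : 0 < r i by rewrite /r mulr_gt0// mulr_gt0//; case: i => [|?].
have rM i : r i <= M.
  rewrite ler_wpM2l ?(ltW l0)//; apply: le_trans kdelta.
  by rewrite ler_wpM2r ?(ltW delta0)//; case: i => //; exact: le_trans k1.
apply: (@le_trans _ _ (\prod_(i < m.+1) (expR (- M) * r i))); last first.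
  apply: ler_prod => i _; rewrite mulr_ge0 ?expR_ge0 ?(ltW (r0 i))//=.
  by rewrite ler_wpM2r ?(ltW (r0 i))// ler_expR lerN2 rM.
rewrite big_split/= prodr_const card_ord -!mulrA ler_wpM2l ?exprn_ge0 ?expR_ge0//.
rewrite big_split/= prodr_const card_ord ler_wpM2l ?exprn_ge0 ?(ltW l0)//.
rewrite big_split/= prodr_const card_ord big_ord_recl/= prodr_const card_ord.
rewrite -mulrA ler_wpM2l ?(ltW al0)// mulrC.
rewrite [delta ^+ _]exprMn mulrCA [leLHS]mulrC.
rewrite ler_wpM2l ?exprn_ge0 ?(ltW d00)//.
rewrite -(powR_mulrn m.+1 (powR_ge0 _ _)) -(powR_mulrn m (ltW k0')) -powRrM.
rewrite -powRD; last by rewrite lt0r_neq0// implybT.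
by rewrite mulNr [gamma^-1 * _]mulrC.
Unshelve. all: by end_near. Qed.

Theorem theorem2p3 (R : realType) (d : measure_display)
    (Omega : measurableType d) (Pr : probability Omega R)
    (lambda lambda' beta gamma gamma' : R) (m : nat)
    (X Y : Omega -> set (R * R)) (A : set R)
    (lambda_gt0 : 0 < lambda) (lambda'_gt0 : 0 < lambda') (beta_gt0 : 0 < beta)
    (gamma_gt0 : 0 < gamma) (gamma_lt1 : gamma < 1)
    (gamma'_gt0 : 0 < gamma') (gamma'_lt1 : gamma' < 1)
    (gamma'_lt : gamma' < 1 / m.+1%:R)
    (poissonX :
      poisson_process Pr (fun B => lambda%:E * strip_measure B)%E X)
    (poissonY :
      poisson_process Pr (fun B => lambda'%:E * strip_measure B)%E Y)
    (indepXY : independent_processes Pr X Y)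
    (measurableA : measurable A) (A1 : lebesgue_measure A = 1%E) :
  (fun k : nat =>
     lne (typical_degree_tail Pr beta gamma gamma' X Y m A k)
       / (ln (k%:R : R))%:E)%E @ \oo
    --> (m%:R - m.+1%:R / gamma)%:E.
Proof.
pose u k : \bar R :=
  (\int[Pr]_w counting (simplices_deg beta gamma gamma' m A k (X w) (Y w)))%E.
have g'm : gamma' * m.+1%:R < 1 by rewrite -ltr_pdivlMr.
have A1' : (lebesgue_measure A <= 1)%E by rewrite A1.
have m0 : 0 < (m.+1%:R : R) by [].
have g01 : 0 < gamma < 1 by rewrite gamma_gt0.
pose s := m.+1%:R / gamma - m%:R.
have -> : m%:R - m.+1%:R / gamma = - s by rewrite opprB.
(* Here s - 1 = (m + 1) (1/gamma - 1) is positive, which makes the order theta = 1 admissible. *)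
have s1 : 1 < s.
  rewrite /s ltrBrDr addrC natr1 ltr_pdivlMr//.
  by rewrite gtr_pMr.
have kappa_lt theta : theta < s -> gamma + gamma * ((theta - 1) / m.+1%:R) < 1.
  move=> ts; rewrite -[X in X + _](mulr1) -mulrDr mulrC -ltr_pdivlMr// mul1r.
  rewrite -ltrBrDl ltr_pdivrMr// mulrBl mul1r.
  by move: ts; rewrite /s -natr1; lra.
have upper theta (j : nat) : 1 <= theta < s -> theta <= j%:R ->
    exists2 C, 0 <= C & forall k, (j <= k)%N -> (u k <= (C * k%:R `^ (- theta))%:E)%E.
  move=> /andP[t1 ts] tj.
  exact: (integral_counting_simplices_deg_le lambda_gt0 lambda'_gt0 beta_gt0 gamma_gt0
    gamma'_gt0 g'm poissonX poissonY indepXY measurableA A1' t1 tj (kappa_lt _ ts)).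
have [c c0 lower] := integral_counting_simplices_deg_ge_powR m lambda_gt0 lambda'_gt0
  beta_gt0 g01 gamma'_gt0 poissonX poissonY indepXY measurableA A1.
(* The lower bound holds for large [k] only, but [u] is nonincreasing. *)
have u1_gt0 : (0 < u 1%N)%E.
  near \oo => k.
  have k0 : (0 < k)%N by near: k; exact: nbhs_infty_gt.
  apply: (@lt_le_trans _ _ (c * k%:R `^ (m%:R - m.+1%:R / gamma))%:E).
    by rewrite lte_fin mulr_gt0// powR_gt0// ltr0n.
  apply: (@le_trans _ _ (u k)); first by near: k; exact: lower.
  apply: ge0_le_lower_integral => w; first exact: counting_ge0.
  by apply: le_counting; exact: le_simplices_deg.
(* The moment bound with theta = j = k = 1 gives a finite intensity. *)
have u1_fin : u 1%N = (fine (u 1%N))%:E.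
  rewrite fineK// ge0_fin_numE ?(ltW u1_gt0)//.
  have [|//|C _ /(_ 1%N (leqnn 1))] := upper 1 1%N; first by rewrite lexx.
  by move=> /le_lt_trans; apply; rewrite ltry.
have L0 : 0 < fine (u 1%N) by rewrite -lte_fin -u1_fin.
rewrite (_ : (fun k => _) = (fun k => lne (u k / (fine (u 1%N))%:E) / (ln (k%:R : R))%:E)%E).
  apply: cvg_log_ratio => //.
    by exists c => //; rewrite opprB.
  move=> theta ts; have [C C0 hC] := upper theta (Num.truncn theta).+1 ts (ltW (truncnS_gt _)).
  exists C => //; exists (Num.truncn theta).+1 => // k /= kt; exact: hC.
by apply/funext => k; rewrite typical_degree_tailE -/(u k) -/(u 1%N) -u1_fin.
Unshelve. all: by end_near. Qed.
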